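(* Let $\alpha\in[1,2]$, and consider the iterates generated by the algorithm adaFRB$_\alpha^+$ described in the context. Then for any solution $x^\star\in\operatorname{zer}T$ the following hold: 1. (Lyapunov descent) $0\le\mathcal U^\alpha_{k+1}(x^\star)\le\mathcal U^\alpha_k(x^\star)$ holds for any $k\in\mathbb N$; in particular, $(x^k)$ is bounded. 2. (Stepsize magnitude) $\gamma_k\ge\min\bigl\{\gamma_0,\frac{c}{\sqrt\alpha\,L_{F,\mathcal V}}\bigr\}$ for any $k\in\mathbb N$, where $L_{F,\mathcal V}$ is a Lipschitz modulus for $F$ on a compact and convex set $\mathcal V$ containing all the iterates $x^k$. 3. (Stampacchia gap) $\displaystyle\min_{k\le K}V_k(x^\star)\le\frac{\mathcal U^\alpha_1(x^\star)}{\sum_{k=1}^{K+1}\gamma_k}$ for all $K\in\mathbb N$, and in particular the left-hand side vanishes with rate $O(1/K)$. 4. (Ergodic subsequential convergence) All cluster points of the (bounded) ergodic sequence $$\bar x^K:=\frac{\sum_{k=2}^K\alpha\gamma_k\bigl(\frac1\alpha+\rho_k-\rho_{k+1}^2\bigr)x^{k-1}+(1+\alpha\rho_{K+1})\gamma_{K+1}x^K}{\sum_{k=2}^K\alpha\gamma_k\bigl(\frac1\alpha+\rho_k-\rho_{k+1}^2\bigr)+(1+\alpha\rho_{K+1})\gamma_{K+1}}$$ are solutions. Up to replacing the parameter $c$ in the stepsize update (the term $\frac{c}{L_k}$) with any $c'\in(0,c)$, one also has the following: 5. $\lim_{k\to\infty}V_k(x^\star)=0$ for any $x^\star\in\operatorname{zer}T$.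 6. $(x^k)$ converges to a solution $x^\infty$ with $\mathcal U^\alpha_k(x^\infty)\to0$.
   Context: Standing assumptions: $F:\mathbb R^n\to\mathbb R^n$ is monotone and locally Lipschitz continuous; $g:\mathbb R^n\to\mathbb R\cup\{+\infty\}$ is proper, convex and lower semicontinuous; $\operatorname{zer}T=\{x:0\in Tx\}\neq\emptyset$, where $Tx:=F(x)+\partial g(x)$; a solution is an element of $\operatorname{zer}T$. $\operatorname{prox}_{\gamma g}(y)=\arg\min_z\{g(z)+\frac1{2\gamma}\|z-y\|^2\}$. Notation: $\Delta_x^k:=x^k-x^{k-1}$, $\Delta_F^k:=F(x^k)-F(x^{k-1})$; $[t]_-:=\max\{-t,0\}$; convention $\frac00=0$, and $\frac{c}{0}=+\infty$ in the stepsize update. Algorithm adaFRB$_\alpha^+$. Choose $\alpha\in[1,2]$, $x^0\in\mathbb R^n$, $\gamma_0>0$, $L_0>0$. Set $x^{-1}=x^{-2}=x^0$, $\rho_0=1$, $$c=\varepsilon=\frac{2\alpha-1}{\alpha(2-\alpha)+\sqrt{\alpha^2(2-\alpha)^2+2(2\alpha-1)(2\alpha+1)^2}},\quad \mu=\frac{\alpha}{1+\alpha},\quad \lambda=2\alpha^2\Bigl(1+\frac1\mu+\frac{2-\alpha}{2\alpha\varepsilon}\Bigr).$$ For $k=0,1,2,\dots$ (with $L_k:=\|\Delta_F^k\|/\|\Delta_x^k\|$ for $k\ge1$, $L_0$ being the given initial parameter): (i) set $$\kappa_k:=[\cos\phi_k]_-=\frac{[\langle\Delta_F^k,\Delta_F^{k-1}\rangle]_-}{\|\Delta_F^k\|\,\|\Delta_F^{k-1}\|},\qquad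 \tau_k=\frac{\langle\Delta_x^k,\Delta_F^{k-1}\rangle}{\frac{\varepsilon}{2\gamma_k\rho_k}\|\Delta_x^k\|^2+\frac{\rho_k\gamma_k}{2\varepsilon}\|\Delta_F^{k-1}\|^2},$$ $$\beta_k=\min\left\{\sqrt{\frac{1+\frac1\mu+\frac{2-\alpha}{2\alpha\varepsilon}}{1+\frac1\mu\kappa_k+\tau_k\frac{2-\alpha}{2\alpha\varepsilon}}},\ \tilde\rho_k\right\},$$ where the square root is read as $+\infty$ if its denominator is $\le0$, and $\tilde\rho_k\in[1,\infty]$ is the smallest solution $\rho$ ($\infty$ if none exists) of the second-order equation $$\Bigl(2(\alpha-1)-\tau_k\alpha\varepsilon(2-\alpha)-2(1+\mu\kappa_k)\alpha^2c^2-\lambda c^2\Bigr)\rho^2-4(1+\mu\kappa_k)c^2\alpha\rho+1-2(1+\mu\kappa_k)c^2=0;$$ (ii) $\gamma_{k+1}=\min\bigl\{\gamma_k\sqrt{\frac1\alpha+\rho_k},\ \beta_k\gamma_k,\ \frac{c}{L_k}\bigr\}$, $\ \rho_{k+1}=\frac{\gamma_{k+1}}{\gamma_k}$; (iii) $u^{k+1}=F(x^k)+\alpha\rho_{k+1}(F(x^k)-F(x^{k-1}))$, $\ x^{k+1}=\operatorname{prox}_{\gamma_{k+1}g}(x^k-\gamma_{k+1}u^{k+1})$. For $x\in\operatorname{dom}g$, $V_k(x):=g(x^k)-g(x)-\langle F(x^k),x-x^k\rangle$, and for $k\in\mathbb N$, with $\lambda$ the constant set at the initialization of the algorithm, $$\mathcal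 U^\alpha_k(x):=\tfrac12\|x^k-x\|^2+\tfrac12\|x^k-x^{k-1}\|^2+\tfrac{\lambda(\gamma_k\rho_k)^2}{2}\|F(x^{k-1})-F(x^{k-2})\|^2+(1+\alpha\rho_k)\gamma_kV_{k-1}(x),$$ with values in $\mathbb R\cup\{+\infty\}$.
   Formalization: In item 1, the inequality U_{k+1} ≤ U_k is stated only for k ≥ 1, since it can fail at k = 0; in item 2 the bound assumes that γ_0 L_0 ≤ c or L_0 ≤ L_{F,V}, since an arbitrarily large initial L_0 would violate it. *)

(* Defs.v *)
From mathcomp Require Import all_boot all_order all_algebra.
From mathcomp Require Import all_classical all_reals all_analysis.
Set Implicit Arguments.
Unset Strict Implicit.
Unset Printing Implicit Defensive.
Import Order.TTheory GRing.Theory Num.Theory.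
Import numFieldNormedType.Exports.
Local Open Scope classical_set_scope.
Local Open Scope ring_scope.

(* Vectors of R^n are rows 'rV[R]_n.  The library norm `|x| of a row is the    *)
(* sup norm, so the Euclidean structure is introduced here; the library        *)
(* topology (and boundedness) on 'rV[R]_n is the usual one.                    *)

Definition dotp (R : realType) (n : nat) (u v : 'rV[R]_n) : R :=
  \sum_(i < n) u 0 i * v 0 i.

Definition enorm (R : realType) (n : nat) (u : 'rV[R]_n) : R :=
  Num.sqrt (dotp u u).

Definition monotone_map (R : realType) (n : nat)
    (F : 'rV[R]_n -> 'rV[R]_n) : Prop :=
  forall x y, 0 <= dotp (F x - F y) (x - y).

Definition lipschitz_modulus (R : realType) (n : nat)
    (F : 'rV[R]_n -> 'rV[R]_n) (A : set 'rV[R]_n) (L : R) : Prop :=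
  0 <= L /\ forall x y, A x -> A y -> enorm (F x - F y) <= L * enorm (x - y).

Definition locally_lipschitz (R : realType) (n : nat)
    (F : 'rV[R]_n -> 'rV[R]_n) : Prop :=
  forall x : 'rV[R]_n, exists2 U : set 'rV[R]_n, nbhs x U & exists L, lipschitz_modulus F U L.

Definition proper_fun (R : realType) (n : nat) (g : 'rV[R]_n -> \bar R) : Prop :=
  (forall x, g x != -oo%E) /\ exists x, g x \is a fin_num.

Definition econvex (R : realType) (n : nat) (g : 'rV[R]_n -> \bar R) : Prop :=
  forall (t : R) (x y : 'rV[R]_n), 0 <= t -> t <= 1 ->
    (g (t *: x + (1 - t) *: y)%R <= t%:E * g x + (1 - t)%:E * g y)%E.

(* For a proper g this set is empty at every x outside dom g. *)
Definition subdifferential (R : realType) (n : nat) (g : 'rV[R]_n -> \bar R)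
    (x : 'rV[R]_n) : set 'rV[R]_n :=
  [set v | forall z, (g x + (dotp v (z - x))%:E <= g z)%E].

Definition opT (R : realType) (n : nat) (F : 'rV[R]_n -> 'rV[R]_n)
    (g : 'rV[R]_n -> \bar R) (x : 'rV[R]_n) : set 'rV[R]_n :=
  [set F x + v | v in subdifferential g x].

Definition zer (R : realType) (n : nat) (T : 'rV[R]_n -> set 'rV[R]_n) :
    set 'rV[R]_n :=
  [set x | T x 0].

(* The argmin set defining prox_{gam g}(y). *)
Definition prox (R : realType) (n : nat) (g : 'rV[R]_n -> \bar R) (gam : R)
    (y : 'rV[R]_n) : set 'rV[R]_n :=
  [set p | forall z, (g p + ((2 * gam)^-1 * enorm (p - y) ^+ 2)%:E
                      <= g z + ((2 * gam)^-1 * enorm (z - y) ^+ 2)%:E)%E].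

Definition negpart (R : realType) (t : R) : R := Num.max (- t) 0.

(* c / d with c / 0 = +oo.  Elsewhere the library convention a / 0 = 0 is used *)
(* and covers the convention 0 / 0 = 0.                                        *)
Definition ediv (R : realType) (c d : R) : \bar R :=
  if d == 0 then +oo%E else (c / d)%:E.

Definition c_par (R : realType) (a : R) : R :=
  (2 * a - 1) /
  (a * (2 - a) + Num.sqrt (a ^+ 2 * (2 - a) ^+ 2
                           + 2 * (2 * a - 1) * (2 * a + 1) ^+ 2)).

Definition eps_par (R : realType) (a : R) : R := c_par a.

Definition mu_par (R : realType) (a : R) : R := a / (1 + a).

Definition lambda_par (R : realType) (a : R) : R :=
  2 * a ^+ 2 * (1 + (mu_par a)^-1 + (2 - a) / (2 * a * eps_par a)).

(* For x : nat -> 'rV[R]_n, truncated subtraction on indices implements        *)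
(* x^{-1} = x^{-2} = x^0: the vector x^{k-1} is x k.-1, and the differences of *)
(* index 0 and -1 are both 0.                                                  *)

Definition dX (R : realType) (n : nat) (x : nat -> 'rV[R]_n) (k : nat) :
    'rV[R]_n :=
  x k - x k.-1.

Definition dF (R : realType) (n : nat) (F : 'rV[R]_n -> 'rV[R]_n)
    (x : nat -> 'rV[R]_n) (k : nat) : 'rV[R]_n :=
  F (x k) - F (x k.-1).

Definition Lk (R : realType) (n : nat) (F : 'rV[R]_n -> 'rV[R]_n) (L0 : R)
    (x : nat -> 'rV[R]_n) (k : nat) : R :=
  if k == 0%N then L0 else enorm (dF F x k) / enorm (dX x k).

Definition kappa (R : realType) (n : nat) (F : 'rV[R]_n -> 'rV[R]_n)
    (x : nat -> 'rV[R]_n) (k : nat) : R :=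
  negpart (dotp (dF F x k) (dF F x k.-1)) /
  (enorm (dF F x k) * enorm (dF F x k.-1)).

Definition tau (R : realType) (n : nat) (F : 'rV[R]_n -> 'rV[R]_n) (a : R)
    (x : nat -> 'rV[R]_n) (gam rho : nat -> R) (k : nat) : R :=
  dotp (dX x k) (dF F x k.-1) /
  (eps_par a / (2 * gam k * rho k) * enorm (dX x k) ^+ 2
   + rho k * gam k / (2 * eps_par a) * enorm (dF F x k.-1) ^+ 2).

Definition quad (R : realType) (a kap tau r : R) : R :=
  (2 * (a - 1) - tau * a * eps_par a * (2 - a)
   - 2 * (1 + mu_par a * kap) * a ^+ 2 * c_par a ^+ 2
   - lambda_par a * c_par a ^+ 2) * r ^+ 2
  - 4 * (1 + mu_par a * kap) * c_par a ^+ 2 * a * r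
  + 1 - 2 * (1 + mu_par a * kap) * c_par a ^+ 2.

(* The set of solutions in [1, +oo[ is closed, so that its infimum is its      *)
(* smallest element when it is not empty, and it is +oo otherwise.             *)
Definition rho_tilde (R : realType) (a kap tau : R) : \bar R :=
  ereal_inf [set r%:E | r in [set r : R | 1 <= r /\ quad a kap tau r = 0]].

Definition beta_root (R : realType) (a kap tau : R) : \bar R :=
  let s := (2 - a) / (2 * a * eps_par a) in
  let den := 1 + (mu_par a)^-1 * kap + tau * s in
  if den <= 0 then +oo%E
  else (Num.sqrt ((1 + (mu_par a)^-1 + s) / den))%:E.

Definition beta (R : realType) (n : nat) (F : 'rV[R]_n -> 'rV[R]_n) (a : R)
    (x : nat -> 'rV[R]_n) (gam rho : nat -> R) (k : nat) : \bar R :=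
  let kap := kappa F x k in
  let t := tau F a x gam rho k in
  Order.min (beta_root a kap t) (rho_tilde a kap t).

(* (x, gam, rho) is a run of adaFRB^+ with parameters a, L0 and initial values *)
(* x 0, gam 0.  The argument cs is the numerator of the third term of the      *)
(* stepsize update, which is c_par a in the original algorithm; it affects     *)
(* nothing else.                                                               *)
Record adaFRBplus (R : realType) (n : nat) (F : 'rV[R]_n -> 'rV[R]_n)
    (g : 'rV[R]_n -> \bar R) (a cs L0 : R)
    (x : nat -> 'rV[R]_n) (gam rho : nat -> R) : Prop := AdaFRBplus {
  ada_gam0 : 0 < gam 0%N ;
  ada_L0 : 0 < L0 ;
  ada_rho0 : rho 0%N = 1 ;
  ada_gam : forall k,
    (gam k.+1)%:E =
    Order.min (gam k * Num.sqrt (a^-1 + rho k))%:E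
      (Order.min (beta F a x gam rho k * (gam k)%:E)%E
                 (ediv cs (Lk F L0 x k))) ;
  ada_rho : forall k, rho k.+1 = gam k.+1 / gam k ;
  ada_x : forall k,
    let u := F (x k) + (a * rho k.+1) *: (F (x k) - F (x k.-1)) in
    prox g (gam k.+1) (x k - gam k.+1 *: u) (x k.+1) }.

Definition gapV (R : realType) (n : nat) (F : 'rV[R]_n -> 'rV[R]_n)
    (g : 'rV[R]_n -> \bar R) (x : nat -> 'rV[R]_n) (k : nat) (z : 'rV[R]_n) :
    \bar R :=
  (g (x k) - g z - (dotp (F (x k)) (z - x k))%:E)%E.

Definition lyapU (R : realType) (n : nat) (F : 'rV[R]_n -> 'rV[R]_n)
    (g : 'rV[R]_n -> \bar R) (a : R) (x : nat -> 'rV[R]_n)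
    (gam rho : nat -> R) (k : nat) (z : 'rV[R]_n) : \bar R :=
  ((2^-1 * enorm (x k - z) ^+ 2
    + 2^-1 * enorm (x k - x k.-1) ^+ 2
    + lambda_par a * (gam k * rho k) ^+ 2 / 2
      * enorm (F (x k.-1) - F (x k.-2)) ^+ 2)%:E
   + ((1 + a * rho k) * gam k)%:E * gapV F g x k.-1 z)%E.

(* min_{k <= K} V_k(z) *)
Definition min_gapV (R : realType) (n : nat) (F : 'rV[R]_n -> 'rV[R]_n)
    (g : 'rV[R]_n -> \bar R) (x : nat -> 'rV[R]_n) (K : nat) (z : 'rV[R]_n) :
    \bar R :=
  (\big[Order.min/+oo]_(k < K.+1) gapV F g x k z)%E.

Definition erg_weight (R : realType) (a : R) (gam rho : nat -> R) (k : nat) : R :=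
  a * gam k * (a^-1 + rho k - rho k.+1 ^+ 2).

Definition ergodic (R : realType) (n : nat) (a : R) (x : nat -> 'rV[R]_n)
    (gam rho : nat -> R) (K : nat) : 'rV[R]_n :=
  (\sum_(2 <= k < K.+1) erg_weight a gam rho k
   + (1 + a * rho K.+1) * gam K.+1)^-1 *:
  (\sum_(2 <= k < K.+1) erg_weight a gam rho k *: x k.-1
   + ((1 + a * rho K.+1) * gam K.+1) *: x K).

Definition compact_convex_cover (R : realType) (n : nat)
    (x : nat -> 'rV[R]_n) (V : set 'rV[R]_n) : Prop :=
  [/\ compact V, convex_set V & forall k, V (x k)].

(* Main.v *)
Require Import Defs.
From mathcomp Require Import all_boot all_order all_algebra.
From mathcomp Require Import all_classical all_reals all_analysis.
From mathcomp Require Import ring lra.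
Set Implicit Arguments.
Unset Strict Implicit.
Unset Printing Implicit Defensive.
Import Order.TTheory GRing.Theory Num.Theory.
Import numFieldNormedType.Exports.
Local Open Scope classical_set_scope.
Local Open Scope ring_scope.

(* With W := rho_{k+1} (D^k - gam_k (1 + a rho_{k+1}) dF^k
+ a rho_k gam_k dF^{k-1}), monotonicity of the subdifferential between x^k and
x^{k+1} gives |D^{k+1}|^2 <= <W, D^{k+1}>, hence <W, D^{k+1}> <= |W|^2.  Adding
the subgradient inequalities of x^{k+1} at z and of x^k at x^{k+1} and x^{k-1},
with weights gam_{k+1}, gam_{k+1} and a rho_{k+1} gam_{k+1}, bounds the
increment of U_k(z) by a quadratic form in D^k, dF^k, dF^{k-1}, for every z in
dom g.  Its coefficients are nonpositive because of the two terms of beta_k,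
and the constant c is the one for which quad(1) >= 0 in the worst case
kappa = tau = 1.  This yields
  U_{k+1}(z) + w_k V_{k-1}(z) + (c^2 - c'^2) |D^k|^2 <= U_k(z),
w_k being the ergodic weights.  Telescoping gives the bound on the gap and,
through Jensen's inequality and Minty's lemma, the ergodic statement.  When
c' < c it also gives D^k -> 0; the prox inequality then forces
gam_{k+1} V_k(z) -> 0, so that all cluster points are solutions, and
U_k(p) -> 0 along a subsequence converging to p, hence along the whole one. *)

(** * Euclidean structure *)

Lemma dotpC (R : realType) n (u v : 'rV[R]_n) : dotp u v = dotp v u.
Proof. by apply: eq_bigr => i _; rewrite mulrC. Qed.

Lemma dotpDl (R : realType) n (u v w : 'rV[R]_n) :
  dotp (u + v) w = dotp u w + dotp v w.
Proof. by rewrite -big_split; apply: eq_bigr => i _; rewrite mxE mulrDl. Qed.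

Lemma dotpZl (R : realType) n (t : R) (u w : 'rV[R]_n) :
  dotp (t *: u) w = t * dotp u w.
Proof. by rewrite /dotp mulr_sumr; apply: eq_bigr => i _; rewrite mxE mulrA. Qed.

Lemma dotpNl (R : realType) n (u w : 'rV[R]_n) : dotp (- u) w = - dotp u w.
Proof. by rewrite -scaleN1r dotpZl mulN1r. Qed.

Lemma dotpDr (R : realType) n (u v w : 'rV[R]_n) :
  dotp w (u + v) = dotp w u + dotp w v.
Proof. by rewrite !(dotpC w) dotpDl. Qed.

Lemma dotpZr (R : realType) n (t : R) (u w : 'rV[R]_n) :
  dotp w (t *: u) = t * dotp w u.
Proof. by rewrite !(dotpC w) dotpZl. Qed.

Lemma dotpNr (R : realType) n (u w : 'rV[R]_n) : dotp w (- u) = - dotp w u.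
Proof. by rewrite !(dotpC w) dotpNl. Qed.

Lemma dotp0l (R : realType) n (w : 'rV[R]_n) : dotp 0 w = 0.
Proof. by rewrite -(scale0r w) dotpZl mul0r. Qed.

Lemma dotp0r (R : realType) n (w : 'rV[R]_n) : dotp w 0 = 0.
Proof. by rewrite dotpC dotp0l. Qed.

Definition dotpE := (dotpDl, dotpDr, dotpNl, dotpNr, dotpZl, dotpZr).

Lemma dotp_sumr (R : realType) n (I : Type) (r : seq I) (P : pred I)
    (f : I -> 'rV[R]_n) (w : 'rV[R]_n) :
  dotp w (\sum_(i <- r | P i) f i) = \sum_(i <- r | P i) dotp w (f i).
Proof.
apply: (big_morph (dotp w)) => [u v|]; [exact: dotpDr | exact: dotp0r].
Qed.

Lemma dotp_ge0 (R : realType) n (u : 'rV[R]_n) : 0 <= dotp u u.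
Proof. by apply: sumr_ge0 => i _; rewrite -expr2 sqr_ge0. Qed.

Lemma enorm_ge0 (R : realType) n (u : 'rV[R]_n) : 0 <= enorm u.
Proof. exact: sqrtr_ge0. Qed.

Lemma enorm_sqr (R : realType) n (u : 'rV[R]_n) : enorm u ^+ 2 = dotp u u.
Proof. by rewrite sqr_sqrtr // dotp_ge0. Qed.

Lemma enorm0 (R : realType) n : enorm (0 : 'rV[R]_n) = 0.
Proof. by rewrite /enorm dotp0l sqrtr0. Qed.

Lemma enormZ (R : realType) n (t : R) (u : 'rV[R]_n) :
  enorm (t *: u) = `|t| * enorm u.
Proof.
by rewrite /enorm dotpZl dotpZr mulrA -expr2 sqrtrM ?sqr_ge0// sqrtr_sqr.
Qed.

Lemma enormN (R : realType) n (u : 'rV[R]_n) : enorm (- u) = enorm u.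
Proof. by rewrite -scaleN1r enormZ normrN1 mul1r. Qed.

Lemma enormB (R : realType) n (u v : 'rV[R]_n) : enorm (u - v) = enorm (v - u).
Proof. by rewrite -enormN opprB. Qed.

Lemma norm_le_enorm (R : realType) n (u : 'rV[R]_n) : `|u| <= enorm u.
Proof.
rewrite /Num.Def.normr /= mx_normrE; apply: bigmax_le => [|i _]; first exact: enorm_ge0.
rewrite -sqrtr_sqr ler_wsqrtr// (ord1 i.1) /dotp (bigD1 i.2)//= -expr2 lerDl.
by apply: sumr_ge0 => j _; rewrite -expr2 sqr_ge0.
Qed.

Lemma enorm_le_norm (R : realType) n (u : 'rV[R]_n) : enorm u <= n%:R * `|u|.
Proof.
rewrite -[leRHS]ger0_norm ?mulr_ge0// -sqrtr_sqr ler_wsqrtr//.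
have coord i : `|u 0 i| <= `|u|.
  rewrite [leRHS]/Num.Def.normr /= mx_normrE.
  by apply: (le_bigmax _ (fun i => `|u i.1 i.2|) (0, i)).
apply: (@le_trans _ _ (\sum_(i < n) `|u| ^+ 2)).
  by apply: ler_sum => i _; rewrite -expr2 -real_normK ?num_real// lerXn2r ?nnegrE.
rewrite sumr_const card_ord exprMn -[leLHS]mulr_natl ler_wpM2r ?sqr_ge0//.
by rewrite -natrX ler_nat; case: (n) => // k; rewrite expnS leq_pmulr// expn_gt0.
Qed.

Lemma enorm_eq0 (R : realType) n (u : 'rV[R]_n) : enorm u = 0 -> u = 0.
Proof.
by move=> u0; apply/eqP; rewrite -normr_le0 (le_trans (norm_le_enorm u))// u0.
Qed.

Lemma dotp_le_enorm (R : realType) n (u v : 'rV[R]_n) :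
  `|dotp u v| <= enorm u * enorm v.
Proof.
have [/enorm_eq0 ->|u0] := eqVneq (enorm u) 0.
  by rewrite dotp0l normr0 enorm0 mul0r.
have [/enorm_eq0 ->|v0] := eqVneq (enorm v) 0.
  by rewrite dotp0r normr0 enorm0 mulr0.
have up : 0 < enorm u by rewrite lt_def u0 enorm_ge0.
have vp : 0 < enorm v by rewrite lt_def v0 enorm_ge0.
have := dotp_ge0 (enorm v *: u - enorm u *: v).
have := dotp_ge0 (enorm v *: u + enorm u *: v).
rewrite !dotpE -!enorm_sqr (dotpC v u) => h1 h2.
rewrite ler_norml; apply/andP; split.
  rewrite -subr_ge0 -(pmulr_rge0 _ up) -(pmulr_rge0 _ vp); lra.
rewrite -subr_ge0 -(pmulr_rge0 _ up) -(pmulr_rge0 _ vp); lra.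
Qed.

Lemma ler_enormD (R : realType) n (u v : 'rV[R]_n) :
  enorm (u + v) <= enorm u + enorm v.
Proof.
rewrite -(@ler_pXn2r _ 2) ?nnegrE ?addr_ge0 ?enorm_ge0//.
rewrite enorm_sqr !dotpE -!enorm_sqr (dotpC v u).
have := le_trans (ler_norm _) (dotp_le_enorm u v); lra.
Qed.

(** * The parameters of the algorithm *)

Lemma c_par_gt0 (R : realType) (a : R) : 1 <= a -> a <= 2 -> 0 < c_par a.
Proof.
move=> a1 a2; have h : 0 < 2 * (2 * a - 1) * (2 * a + 1) ^+ 2.
  by rewrite !mulr_gt0 ?exprn_gt0//; lra.
rewrite /c_par divr_gt0//; first lra.
rewrite ltr_wpDl ?mulr_ge0//; [lra|lra|].
by rewrite sqrtr_gt0 (lt_le_trans h)// lerDr mulr_ge0 ?sqr_ge0.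
Qed.

(* [c_par] is the positive root of a quadratic equation, rationalised. *)
Lemma c_par_eq (R : realType) (a : R) : 1 <= a -> a <= 2 ->
  2 * (2 * a + 1) ^+ 2 * c_par a ^+ 2 + 2 * a * (2 - a) * c_par a = 2 * a - 1.
Proof.
move=> a1 a2; have := c_par_gt0 a1 a2; rewrite /c_par.
set s := Num.sqrt _; set p := a * (2 - a).
have s2 : s ^+ 2 = p ^+ 2 + 2 * (2 * a - 1) * (2 * a + 1) ^+ 2.
  rewrite sqr_sqrtr ?exprMn//; apply: addr_ge0; first by rewrite mulr_ge0 ?sqr_ge0.
  by rewrite !mulr_ge0 ?sqr_ge0//; lra.
have a0 : 0 < 2 * a - 1 by lra.
rewrite pmulr_rgt0 ?invr_gt0 // => d0.
have dN : p + s != 0 by rewrite gt_eqF.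
have -> : 2 * a * (2 - a) = 2 * p by rewrite /p mulrA.
have e : 2 * (2 * a + 1) ^+ 2 * (2 * a - 1) + 2 * p * (p + s) = (p + s) ^+ 2.
  by rewrite [RHS]sqrrD s2; ring.
apply: (mulIf (expf_neq0 2 dN)).
transitivity ((2 * a - 1) * (2 * (2 * a + 1) ^+ 2 * (2 * a - 1) + 2 * p * (p + s))).
  by field.
by rewrite e.
Qed.

Lemma mu_par_gt0 (R : realType) (a : R) : 1 <= a -> 0 < mu_par a.
Proof. by move=> a1; rewrite divr_gt0; lra. Qed.

(** Since [eps_par a] equals [c_par a], one factor [c_par a] clears the denominator in [lambda_par];
    the remainder uses 1 + 1/mu = (2a + 1)/a. *)
Lemma lambda_parE (R : realType) (a : R) : 1 <= a -> a <= 2 ->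
  lambda_par a * c_par a = 2 * a * (2 * a + 1) * c_par a + a * (2 - a).
Proof.
move=> a1 a2; have c0 := c_par_gt0 a1 a2.
by rewrite /lambda_par /eps_par /mu_par; field; lra.
Qed.

Lemma lambda_par_ge0 (R : realType) (a : R) : 1 <= a -> a <= 2 ->
  0 <= lambda_par a.
Proof.
move=> a1 a2; have c0 := c_par_gt0 a1 a2.
rewrite -(pmulr_lge0 _ c0) lambda_parE//.
by move: (c_par a) c0 => c c0; rewrite addr_ge0 ?mulr_ge0//; lra.
Qed.

(* The constant [c_par a] is chosen so that this holds with equality at
   [kap = tau = 1]. *)
Lemma quad1_ge0 (R : realType) (a kap t : R) : 1 <= a -> a <= 2 ->
  kap <= 1 -> t <= 1 -> 0 <= quad a kap t 1.
Proof.
move=> a1 a2 k1 t1; have c0 := c_par_gt0 a1 a2.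
have ce := c_par_eq a1 a2; have le := lambda_parE a1 a2.
have mu0 := mu_par_gt0 a1.
have mue : mu_par a * (1 + a) = a by rewrite /mu_par divfK//; lra.
rewrite /quad /eps_par.
have -> : lambda_par a * c_par a ^+ 2 = (2 * a * (2 * a + 1) * c_par a + a * (2 - a)) * c_par a.
  by rewrite -le; ring.
move: (c_par a) (mu_par a) c0 ce mu0 mue {le} => c mu c0 ce mu0 mue.
have h1 : 0 <= (1 - t) * (a * c * (2 - a)) by rewrite !mulr_ge0//; lra.
have h2 : 0 <= mu * (1 - kap) * (1 + a) ^+ 2 * c ^+ 2.
  by rewrite !mulr_ge0 ?sqr_ge0//; lra.
suff -> : (2 * (a - 1) - t * a * c * (2 - a) - 2 * (1 + mu * kap) * a ^+ 2 * c ^+ 2 -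
  (2 * a * (2 * a + 1) * c + a * (2 - a)) * c) * 1 ^+ 2 -
  4 * (1 + mu * kap) * c ^+ 2 * a * 1 + 1 - 2 * (1 + mu * kap) * c ^+ 2
  = (1 - t) * (a * c * (2 - a)) + 2 * (mu * (1 - kap) * (1 + a) ^+ 2 * c ^+ 2).
  lra.
apply/eqP; rewrite -subr_eq0; apply/eqP.
transitivity ((2 * a - 1 - (2 * (2 * a + 1) ^+ 2 * c ^+ 2 + 2 * a * (2 - a) * c))
   + 2 * c ^+ 2 * (1 + a) * (a - mu * (1 + a))); first by ring.
by rewrite ce mue; ring.
Qed.

(** Write the polynomial as A r^2 - 4 a B r + 1 - 2 B with B = (1 + mu kap) c^2. If A < 0 it
    decreases on r >= 0 and its value at 1 decides; if A >= 0 the quadratic term is dropped and 2 (1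
    + 2a) B <= 1 suffices. *)
Lemma quad_ge0_le1 (R : realType) (a kap t r : R) : 1 <= a -> a <= 2 ->
  0 <= kap -> kap <= 1 -> t <= 1 -> 0 <= r -> r <= 1 -> 0 <= quad a kap t r.
Proof.
move=> a1 a2 k0 k1 t1 r0 r1; have := quad1_ge0 a1 a2 k1 t1.
have c0 := c_par_gt0 a1 a2.
have ce := c_par_eq a1 a2; have mu0 := mu_par_gt0 a1.
have mue : mu_par a * (1 + a) = a by rewrite /mu_par divfK//; lra.
rewrite /quad.
set A := (2 * (a - 1) - _ - _ - _); move: A => A.
move: (c_par a) (mu_par a) c0 ce mu0 mue => c mu c0 ce mu0 mue.
have B0 : 0 <= (1 + mu * kap) * c ^+ 2.
  by rewrite mulr_ge0 ?sqr_ge0// addr_ge0// mulr_ge0// ltW.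
(* As mu (1 + a) = a, (1 + mu kap)(1 + a) <= 1 + 2a; and [c_par_eq] bounds 2 (1 + 2a)^2 c^2 by 2a -
   1 <= 1 + a. *)
have B1 : 2 * (1 + 2 * a) * ((1 + mu * kap) * c ^+ 2) <= 1.
  have h1 : (1 + mu * kap) * (1 + a) <= 1 + 2 * a.
    by have := ler_wpM2l (ltW mu0) k1; nra.
  have h2 : 2 * (1 + 2 * a) ^+ 2 * c ^+ 2 <= 2 * a - 1.
    rewrite -ce (addrC 1) lerDl !mulr_ge0//; lra.
  have h3 : 2 * (1 + 2 * a) * ((1 + mu * kap) * c ^+ 2) * (1 + a) <= 2 * a - 1.
    apply: le_trans h2.
    have -> : 2 * (1 + 2 * a) * ((1 + mu * kap) * c ^+ 2) * (1 + a) =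
      ((1 + mu * kap) * (1 + a)) * (2 * (1 + 2 * a) * c ^+ 2) by ring.
    have -> : 2 * (1 + 2 * a) ^+ 2 * c ^+ 2 = (1 + 2 * a) * (2 * (1 + 2 * a) * c ^+ 2) by ring.
    by apply: ler_wpM2r => //; rewrite !mulr_ge0 ?sqr_ge0//; lra.
  rewrite -(@ler_pM2r _ (1 + a)); lra.
have e x : 4 * (1 + mu * kap) * c ^+ 2 * a * x = 4 * a * ((1 + mu * kap) * c ^+ 2) * x.
  by ring.
rewrite !e.
have -> : 2 * (1 + mu * kap) * c ^+ 2 = 2 * ((1 + mu * kap) * c ^+ 2) by ring.
move: B0 B1; move: ((1 + mu * kap) * c ^+ 2) => B B0 B1.
have [A0|A0] := leP 0 A.
  move=> _; have := mulr_ge0 A0 (sqr_ge0 r).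
  have : 4 * a * B * r <= 4 * a * B by rewrite ler_piMr// !mulr_ge0//; lra.
  lra.
have hr : r ^+ 2 <= 1 by rewrite expr_le1.
have : 4 * a * B * r <= 4 * a * B by rewrite ler_piMr// !mulr_ge0//; lra.
by move: (ler_wnM2l (ltW A0) hr); rewrite expr1n !mulr1; lra.
Qed.

Lemma quadratic_ivt (R : realType) (A B C x y : R) : x <= y ->
  0 <= A * x ^+ 2 + (- (B * x) + C) -> A * y ^+ 2 + (- (B * y) + C) <= 0 ->
  exists2 u, x <= u <= y & A * u ^+ 2 + (- (B * u) + C) = 0.
Proof.
(* The sign is reversed because [poly_ivt] expects a polynomial going from nonpositive to
   nonnegative values. *)
move=> xy hx hy; pose p := - (A *: 'X^2 + (- (B *: 'X) + C%:P)).
have pE z : p.[z] = - (A * z ^+ 2 + (- (B * z) + C)).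
  by rewrite /p !(hornerN, hornerD, hornerZ, hornerXn, hornerX, hornerC).
have [|u xuy /rootP pu] := @poly_ivt _ p x y xy.
  by rewrite !pE oppr_le0 oppr_ge0 hx hy.
by exists u => //; apply/eqP; rewrite -oppr_eq0 -pE pu.
Qed.

(** Beyond 1, a negative value at r would force a root in [1, r], because the value at 1 is
    nonnegative. That root bounds [rho_tilde] from above, so it equals r, where the value is then
    0. *)
Lemma quad_ge0 (R : realType) (a kap t r : R) : 1 <= a -> a <= 2 ->
  0 <= kap -> kap <= 1 -> t <= 1 -> 0 <= r ->
  (r%:E <= rho_tilde a kap t)%E -> 0 <= quad a kap t r.
Proof.
move=> a1 a2 k0 k1 t1 r0 rle; have [r1|r1] := leP r 1.
  exact: quad_ge0_le1.
rewrite leNgt; apply/negP => qr.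
have [u /andP[u1 ur] qu] : exists2 u, 1 <= u <= r & quad a kap t u = 0.
  have q1 := quad1_ge0 a1 a2 k1 t1; move: q1 qr; rewrite /quad -!addrA => q1 qr.
  have [u u1r] := quadratic_ivt (ltW r1) q1 (ltW qr).
  by exists u => //; rewrite -!addrA.
have : (rho_tilde a kap t <= u%:E)%E.
  by apply: ereal_inf_lbound; exists u.
move/(le_trans rle); rewrite lee_fin => ru.
by move: qr; rewrite (_ : r = u) ?qu ?ltxx//; apply/eqP; rewrite eq_le ru ur.
Qed.

Lemma rho_tilde_ge1 (R : realType) (a kap t : R) : (1 <= rho_tilde a kap t)%E.
Proof.
by apply: le_ereal_inf_tmp => _ [r [r1 _] <-]; rewrite lee_fin.
Qed.

(** * The one-step estimate *)

(* [w = x k - z], [D = dX k], [E = dX k.+1], [f = F (x k)], [P = dF k],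
   [Q = dF k.-1], and [s], [r] are [rho k], [rho k.+1]; [G0], [G1], [G2], [Gz]
   are the values of [g] at [x k.-1], [x k], [x k.+1], [z]. *)
Lemma reflected_step (R : realType) n (a gm r s G0 G1 G2 Gz : R)
    (w D E f P Q : 'rV[R]_n) :
  0 <= a -> 0 <= r ->
  gm * G1 + dotp (- D - gm *: (f - P + (a * s) *: Q)) E <= gm * G2 ->
  gm * G1 + dotp (- D - gm *: (f - P + (a * s) *: Q)) (- D) <= gm * G0 ->
  r * gm * G2 + dotp (- E - (r * gm) *: (f + (a * r) *: P)) (- (w + E))
    <= r * gm * Gz ->
  r * gm * G2 + dotp (- E - (r * gm) *: (f + (a * r) *: P)) (- E)
    <= r * gm * G1 ->
  2^-1 * dotp (w + E) (w + E) + 2^-1 * dotp E E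
    + (1 + a * r) * (r * gm) * (G1 - Gz + dotp f w)
  <= 2^-1 * dotp w w + a * r ^+ 2 * gm * (G0 - Gz + dotp (f - P) (w - D))
     + r ^+ 2 * dotp (D - (gm * (1 + a * r)) *: P + (a * s * gm) *: Q)
                     (D - (gm * (1 + a * r)) *: P + (a * s * gm) *: Q)
     - a * r ^+ 2 * dotp D D - a ^+ 2 * r ^+ 2 * gm * s * dotp Q D.
Proof.
move=> a0 r0 s2 s3 s1 s4; set W := (X in r ^+ 2 * dotp X X).
have h2 := ler_wpM2l r0 s2; have h3 := ler_wpM2l (mulr_ge0 a0 (sqr_ge0 r)) s3.
have hEW : dotp E E <= r * dotp W E.
  by move: s4 h2; rewrite /W !dotpE; lra.
have hW : r * dotp W E <= r ^+ 2 * dotp W W.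
  move: W hEW => V hEV; have := dotp_ge0 (r *: V - E).
  by rewrite !dotpE (dotpC E V); lra.
have : 2^-1 * dotp (w + E) (w + E) + 2^-1 * dotp E E
    + (1 + a * r) * (r * gm) * (G1 - Gz + dotp f w)
  <= 2^-1 * dotp w w + a * r ^+ 2 * gm * (G0 - Gz + dotp (f - P) (w - D))
     + r * dotp W E
     - a * r ^+ 2 * dotp D D - a ^+ 2 * r ^+ 2 * gm * s * dotp Q D.
  move: h2 h3 s1; rewrite /W !dotpE (dotpC w E); lra.
lra.
Qed.

(** The scalars are the squared norms, norms and inner products of D, P, Q in [reflected_step].
    Monotonicity discards [dp], kappa with Young's inequality absorbs [pq], tau rewrites [dq], and
    the stepsize bound trades [pp] for [dd]. What remains at [qq] is the square-root term of beta_k,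
    and at [dd] minus one half of [quad]. *)
Lemma mixed_terms_le (R : realType) (a cs kap t gm r s dd pp qq np nq pq dq dp : R) :
  1 <= a -> a <= 2 -> 0 <= gm -> 0 <= r -> 0 <= s -> 0 <= kap ->
  0 <= cs -> cs <= c_par a ->
  0 <= dd -> np ^+ 2 = pp -> nq ^+ 2 = qq ->
  0 <= dp -> - pq <= kap * (np * nq) ->
  gm * s * dq = t * (eps_par a / 2 * dd + (s * gm) ^+ 2 / (2 * eps_par a) * qq) ->
  (r * gm) ^+ 2 * pp <= cs ^+ 2 * dd ->
  r ^+ 2 * (1 + (mu_par a)^-1 * kap + t * ((2 - a) / (2 * a * eps_par a)))
    <= 1 + (mu_par a)^-1 + (2 - a) / (2 * a * eps_par a) ->
  0 <= quad a kap t r ->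
  r ^+ 2 * (dd + (gm * (1 + a * r)) ^+ 2 * pp + (a * s * gm) ^+ 2 * qq
    - 2 * (gm * (1 + a * r)) * dp + 2 * (a * s * gm) * dq
    - 2 * (gm * (1 + a * r)) * (a * s * gm) * pq)
  - a * r ^+ 2 * dd - a ^+ 2 * r ^+ 2 * gm * s * dq
  + lambda_par a * ((r * gm) * r) ^+ 2 / 2 * pp
  + (c_par a ^+ 2 - cs ^+ 2) * dd
  <= 2^-1 * dd + lambda_par a * (gm * s) ^+ 2 / 2 * qq.
Proof.
move=> a1 a2 g0 r0 s0 k0 cs0 csc d0 np2 nq2 dp0 hpq hdq hc hb hq.
have c0 := c_par_gt0 a1 a2; have mu0 := mu_par_gt0 a1.
have l0 := lambda_par_ge0 a1 a2.
have lE : lambda_par a / 2 =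
    a ^+ 2 * (1 + (mu_par a)^-1 + (2 - a) / (2 * a * eps_par a)).
  by rewrite /lambda_par; field; move: c0; rewrite /eps_par; lra.
move: hq hdq hb lE; rewrite /quad /eps_par.
move: (c_par a) (mu_par a) (lambda_par a) c0 mu0 l0 csc => c mu lam c0 mu0 l0 csc.
move=> hq hdq hb lE; set sg := (2 - a) / (2 * a * c) in hb lE.
pose A := gm * (1 + a * r) * np; pose B := a * s * gm * nq.
have ar0 : 0 <= 1 + a * r by rewrite addr_ge0 ?mulr_ge0//; lra.
have ka0 : 0 <= mu * kap by rewrite mulr_ge0// ltW.
(* Young's inequality [2 A B <= mu A^2 + B^2 / mu] *)
have hAB : - 2 * (gm * (1 + a * r)) * (a * s * gm) * pq
    <= kap * (mu * A ^+ 2 + mu^-1 * B ^+ 2).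
  have y : 2 * (A * B) <= mu * A ^+ 2 + mu^-1 * B ^+ 2.
    have := mulr_ge0 (ltW mu0) (sqr_ge0 (A - mu^-1 * B)).
    have -> : mu * (A - mu^-1 * B) ^+ 2 = mu * A ^+ 2 - 2 * (A * B) + mu^-1 * B ^+ 2.
      by field; lra.
    lra.
  apply: le_trans (ler_wpM2l k0 y).
  have asg : 0 <= 2 * (gm * (1 + a * r)) * (a * s * gm) by rewrite ?mulr_ge0//; lra.
  have := ler_wpM2l asg hpq; rewrite /A /B; lra.
have A2 : A ^+ 2 = (gm * (1 + a * r)) ^+ 2 * pp by rewrite /A exprMn np2.
have B2 : B ^+ 2 = (a * s * gm) ^+ 2 * qq by rewrite /B exprMn nq2.
have hA : r ^+ 2 * A ^+ 2 <= (1 + a * r) ^+ 2 * (cs ^+ 2 * dd).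
  rewrite A2.
  have -> : r ^+ 2 * ((gm * (1 + a * r)) ^+ 2 * pp)
    = (1 + a * r) ^+ 2 * ((r * gm) ^+ 2 * pp) by ring.
  by rewrite ler_wpM2l ?sqr_ge0.
have hB := ler_wpM2r (sqr_ge0 B) hb.
(* The value of lambda is the one that turns this term into B^2 times the numerator under the root
   in beta_k. *)
have hlq : lam * (gm * s) ^+ 2 / 2 * qq = (1 + mu^-1 + sg) * B ^+ 2.
  rewrite B2; transitivity (lam / 2 * (gm * s) ^+ 2 * qq); first by ring.
  by rewrite lE; ring.
have hlp : lam * (r * gm * r) ^+ 2 / 2 * pp <= lam / 2 * r ^+ 2 * (cs ^+ 2 * dd).
  have -> : lam * (r * gm * r) ^+ 2 / 2 * pp = lam / 2 * r ^+ 2 * ((r * gm) ^+ 2 * pp).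
    by ring.
  by rewrite ler_wpM2l// mulr_ge0 ?sqr_ge0// divr_ge0.
(* The two occurrences of [dq], one from |W|^2 and one from the subgradient inequality at x^{k-1},
   combine into the factor a (2 - a). *)
have hD : (2 * a - a ^+ 2) * (gm * s * dq) =
    t * a * c * (2 - a) / 2 * dd + t * sg * B ^+ 2.
  by rewrite hdq B2 /sg; field; lra.
have hdd := mulr_ge0 hq d0.
have cc : 0 <= c ^+ 2 - cs ^+ 2 by rewrite subr_ge0 lerXn2r// nnegrE// ltW.
(* [quad] is written with c while the stepsize uses [cs]; the difference enters the coefficient of
   [dd] with a factor at least 1. *)
have slack : (c ^+ 2 - cs ^+ 2) * dd <=
   ((1 + mu * kap) * (1 + a * r) ^+ 2 + lam / 2 * r ^+ 2) * ((c ^+ 2 - cs ^+ 2) * dd).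
  rewrite ler_peMl ?mulr_ge0//.
  have h1 : 1 <= (1 + a * r) ^+ 2 by rewrite expr_ge1// lerDl mulr_ge0//; lra.
  have h2 : 0 <= mu * kap * (1 + a * r) ^+ 2 by rewrite mulr_ge0 ?sqr_ge0.
  have h3 : 0 <= lam / 2 * r ^+ 2 by rewrite mulr_ge0 ?sqr_ge0// divr_ge0.
  lra.
have hA' := ler_wpM2l ka0 hA.
have hAB' := ler_wpM2l (sqr_ge0 r) hAB.
have hdp : 0 <= r ^+ 2 * (2 * (gm * (1 + a * r)) * dp).
  by rewrite ?mulr_ge0// sqr_ge0.
have hD' := congr1 ( *%R (r ^+ 2)) hD.
rewrite hlq; rewrite -[(gm * (1 + a * r)) ^+ 2 * pp]A2 -[(a * s * gm) ^+ 2 * qq]B2.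
move: (A ^+ 2) (B ^+ 2) hA hB hlp hdd slack hA' hAB' hdp hD' => A2' B2'.
move: sg hb lE hlq hD => sg *.
lra.
Qed.

(** * Proximal points and solutions *)

(** An elementary form of letting t tend to 0: if A > 0 then B > 0, and t = min(d, A / (2B)) would
    give A <= A/2. *)
Lemma le0_of_small (R : realType) (A B d : R) : 0 < d ->
  (forall t, 0 < t -> t <= d -> A <= t * B) -> A <= 0.
Proof.
move=> d0 h; rewrite leNgt; apply/negP => A0.
have B0 : 0 < B by have := lt_le_trans A0 (h _ d0 (lexx d)); rewrite pmulr_rgt0.
have t0 : 0 < Num.min d (A / (2 * B)) by rewrite lt_min d0 divr_gt0// mulr_gt0.
have := h _ t0; rewrite ge_min lexx => /(_ isT).
apply/negP; rewrite -ltNge (@le_lt_trans _ _ (A / (2 * B) * B))//.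
  by rewrite ler_pM2r// ge_min lexx orbT.
rewrite (_ : _ * B = A / 2); last by field; lra.
lra.
Qed.

Lemma proper_fin (R : realType) n (g : 'rV[R]_n -> \bar R) x (r : R) :
  proper_fun g -> (g x <= r%:E)%E -> g x \is a fin_num.
Proof.
by move=> [gN _] gr; rewrite fin_numE gN -ltey (le_lt_trans gr)// ltry.
Qed.

Lemma proper_dom (R : realType) n (g : 'rV[R]_n -> \bar R) x :
  proper_fun g -> (g x < +oo)%E -> g x \is a fin_num.
Proof. by move=> [gN _] gr; rewrite fin_numE gN -ltey. Qed.

Lemma prox_fin (R : realType) n (g : 'rV[R]_n -> \bar R) gam y p :
  proper_fun g -> prox g gam y p -> g p \is a fin_num.
Proof.
move=> gp; have [_ [z gz]] := gp => /(_ z); rewrite -(fineK gz) -EFinD.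
by rewrite -leeBrDr// -EFinB; apply: proper_fin.
Qed.

(* The segment as it is written in [econvex]. *)
Lemma segmentE (R : realType) n (t : R) (z p : 'rV[R]_n) :
  t *: z + (1 - t) *: p = p + t *: (z - p).
Proof. by rewrite scalerBl scale1r scalerBr addrCA addrA. Qed.

Lemma econvex_fine (R : realType) n (g : 'rV[R]_n -> \bar R) t z p :
  proper_fun g -> econvex g -> g z \is a fin_num -> g p \is a fin_num ->
  0 <= t -> t <= 1 ->
  g (p + t *: (z - p)) \is a fin_num /\
  fine (g (p + t *: (z - p))) <= t * fine (g z) + (1 - t) * fine (g p).
Proof.
move=> gp gc gz gpp t0 t1; have := gc _ z p t0 t1.
rewrite -{1}(fineK gz) -{1}(fineK gpp) -!EFinM -EFinD segmentE => h.
by have hf := proper_fin gp h; split => //; rewrite -lee_fin fineK.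
Qed.

(** Minimality of [p] is tested at [p + t (z - p)]. After convexity and division by t, the only
    excess is t |z - p|^2 / 2, which vanishes as t tends to 0. *)
Lemma prox_ineq (R : realType) n (g : 'rV[R]_n -> \bar R) gam y p z :
  proper_fun g -> econvex g -> 0 < gam -> prox g gam y p ->
  g z \is a fin_num ->
  gam * fine (g p) + dotp (y - p) (z - p) <= gam * fine (g z).
Proof.
move=> gp gc g0 ppr gz; have pf := prox_fin gp ppr.
rewrite -subr_le0; apply: (@le0_of_small _ _ (2^-1 * dotp (z - p) (z - p)) 1) => // t t0 t1.
have [sf sle] := econvex_fine gp gc gz pf (ltW t0) t1.
have := ppr (p + t *: (z - p)); rewrite -(fineK pf) -(fineK sf) -!EFinD lee_fin !enorm_sqr.
rewrite addrAC -(opprB p y) dotpNl; move: (z - p) (p - y) sle => v u sle.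
rewrite !dotpE (dotpC v u) => h; rewrite -(ler_pM2l t0).
have q : 2 * gam * (2 * gam)^-1 = 1 by rewrite divff//; lra.
have h' : gam * (fine (g p) + (2 * gam)^-1 * dotp u u)
   <= gam * (t * fine (g z) + (1 - t) * fine (g p)
       + (2 * gam)^-1 * (dotp u u + t * dotp u v + (t * dotp u v + t * (t * dotp v v)))).
  by rewrite (ler_pM2l g0) (le_trans h)// lerD2r.
have e x : gam * ((2 * gam)^-1 * x) = 2^-1 * x.
  by rewrite mulrA; congr (_ * _); lra.
by move: h'; rewrite !(mulrDr gam) !e; lra.
Qed.

Lemma zerP (R : realType) n (F : 'rV[R]_n -> 'rV[R]_n) g x :
  zer (opT F g) x <-> subdifferential g x (- F x).
Proof.
split=> [[v gv e]|h]; last by exists (- F x) => //; rewrite subrr.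
by rewrite (_ : - F x = v)//; apply/eqP; rewrite eq_sym -addr_eq0 addrC e.
Qed.

Lemma zer_fin (R : realType) n (F : 'rV[R]_n -> 'rV[R]_n) g x :
  proper_fun g -> zer (opT F g) x -> g x \is a fin_num.
Proof.
move=> gp /zerP h; have [_ [z gz]] := gp; have := h z.
by rewrite -(fineK gz) -leeBrDr// -EFinB; apply: proper_fin.
Qed.

Lemma zer_ineq (R : realType) n (F : 'rV[R]_n -> 'rV[R]_n) g x y :
  proper_fun g -> zer (opT F g) x -> g y \is a fin_num ->
  0 <= fine (g y) - fine (g x) + dotp (F x) (y - x).
Proof.
move=> gp h yf; have xf := zer_fin gp h; move/zerP: h => /(_ y).
by rewrite -(fineK yf) -(fineK xf) -EFinD lee_fin dotpNl; lra.
Qed.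

(** This is the error term of Minty's lemma. For t up to e / (|v| + 1) the point stays in the ball
    of radius e where a local modulus holds; the added 1 covers [v = 0]. *)
Lemma locally_lipschitz_dotp (R : realType) n (F : 'rV[R]_n -> 'rV[R]_n) p v :
  locally_lipschitz F -> exists d, 0 < d /\ exists B, forall t, 0 < t -> t <= d ->
    `|dotp (F (p + t *: v) - F p) v| <= t * B.
Proof.
move=> /(_ p)[U /nbhs_ballP[e /= e0 eU] [L [L0 FL]]].
have d0 : 0 < e / (`|v| + 1) by rewrite divr_gt0// ltr_wpDl.
exists (e / (`|v| + 1)); split => //.
exists (L * enorm v * enorm v) => t t0 td.
have Up : U p by apply: eU; exact: ballxx.
have Uq : U (p + t *: v).
  apply: eU; rewrite -ball_normE /= opprD addrA subrr sub0r normrN normrZ gtr0_norm//.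
  apply: (@lt_le_trans _ _ (t * (`|v| + 1))); first by rewrite ltr_pM2l// ltrDl.
  by rewrite -ler_pdivlMr// ltr_wpDl.
apply: (le_trans (dotp_le_enorm _ _)).
have := FL _ _ Uq Up; rewrite [X in _ * enorm X]addrAC subrr add0r enormZ gtr0_norm// => h.
have := ler_wpM2r (enorm_ge0 v) h; lra.
Qed.

(* Minty's lemma: the inequality is linearised at [p + t (z - p)], [t -> 0]. *)
Lemma minty (R : realType) n (F : 'rV[R]_n -> 'rV[R]_n) g p :
  locally_lipschitz F -> proper_fun g -> econvex g -> g p \is a fin_num ->
  (forall z, g z \is a fin_num ->
     fine (g p) - fine (g z) + dotp (F z) (p - z) <= 0) ->
  zer (opT F g) p.
Proof.
move=> Fl gp gc pf h; apply/zerP => z.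
have [gz|gz] := ltP (g z) +oo%E; last first.
  by apply: le_trans gz; rewrite leey.
have zf := proper_dom gp gz; rewrite -(fineK pf) -(fineK zf) -EFinD lee_fin dotpNl.
have [d [d0 [B FB]]] := @locally_lipschitz_dotp _ _ F p (z - p) Fl.
rewrite -subr_le0; apply: (@le0_of_small _ _ B (Num.min d 1)).
  by rewrite lt_min d0 ltr01.
move=> t t0; rewrite le_min => /andP[td t1].
have [sf sle] := econvex_fine gp gc zf pf (ltW t0) t1.
have := h _ sf; rewrite opprD addrA subrr sub0r dotpNr dotpZr => h1.
have := FB _ t0 td; rewrite ler_norml dotpDl dotpNl => /andP[_ h2].
have : t * (fine (g p) - fine (g z) - dotp (F (p + t *: (z - p))) (z - p)) <= 0 by lra.
by rewrite pmulr_rle0//; lra.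
Qed.

Lemma cluster_seq_near (R : realType) n (y : nat -> 'rV[R]_n) p (P : nat -> Prop) B :
  cluster (y @ \oo) p -> (\forall K \near \oo, P K) -> nbhs p B ->
  exists K, P K /\ B (y K).
Proof.
move=> yp PK pB; have [|_ [[K PK' <-] BK]] := yp (y @` [set K | P K]) B _ pB.
  by apply: filterS PK => K; exists K.
by exists K.
Qed.

Lemma dotp_near (R : realType) n (v p : 'rV[R]_n) (d : R) : 0 < d ->
  nbhs p [set q | `|dotp v (q - p)| < d].
Proof.
(* Neighbourhoods are balls for the sup norm, hence the factor n that converts it to the Euclidean
   norm. *)
move=> d0; have e0 : 0 < d / (n%:R * enorm v + 1).
  by rewrite divr_gt0// ltr_wpDl// mulr_ge0// enorm_ge0.
apply/nbhs_ballP; exists (d / (n%:R * enorm v + 1)) => //= q.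
rewrite -ball_normE /= => h; apply: (le_lt_trans (dotp_le_enorm _ _)).
apply: (@le_lt_trans _ _ (enorm v * (n%:R * `|p - q|))).
  by rewrite ler_wpM2l ?enorm_ge0// enormB enorm_le_norm.
rewrite mulrA (mulrC (enorm v)).
apply: (@le_lt_trans _ _ (`|p - q| * (n%:R * enorm v + 1))).
  by rewrite [leRHS]mulrC ler_wpM2r// lerDl.
by rewrite -ltr_pdivlMr// ltr_wpDl// mulr_ge0// enorm_ge0.
Qed.

(** The hypothesis is Minty's inequality up to a vanishing error, the form in which both the ergodic
    averages and the iterates satisfy it. Lower semicontinuity passes it to the cluster point, and a
    point of dom g makes [g p] finite. *)
Lemma cluster_zer (R : realType) n (F : 'rV[R]_n -> 'rV[R]_n) g
    (y : nat -> 'rV[R]_n) p :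
  locally_lipschitz F -> proper_fun g -> econvex g -> lower_semicontinuous g ->
  cluster (y @ \oo) p ->
  (forall z d, g z \is a fin_num -> 0 < d -> \forall K \near \oo,
     (g (y K) <= (fine (g z) - dotp (F z) (y K - z) + d)%:E)%E) ->
  zer (opT F g) p.
Proof.
move=> Fl gp gc gl yp h.
have lim z : g z \is a fin_num -> (g p <= (fine (g z) - dotp (F z) (p - z))%:E)%E.
  move=> zf; apply/lee_addgt0Pr => d d0; rewrite leNgt -EFinD; apply/negP => /gl[V pV Vg].
  have d2 : 0 < d / 2 by lra.
  (* Half of d pays for the asymptotic inequality, half for moving the linear term from [y K] to
     [p]. *)
  have [K [hK [VK dK]]] := cluster_seq_near yp (h z _ zf d2)
     (filterI pV (dotp_near (F z) p d2)).
  have := lt_le_trans (Vg _ VK) hK; apply/negP; rewrite -leNgt lee_fin.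
  move: dK; rewrite /= ltr_norml => /andP[dK _].
  have -> : y K - z = (y K - p) + (p - z) by rewrite addrA subrK.
  rewrite (dotpDr (y K - p)); lra.
have [_ [z0 z0f]] := gp.
have pf := proper_fin gp (lim _ z0f).
apply: minty => // z zf; have := lim _ zf; rewrite -{1}(fineK pf) lee_fin; lra.
Qed.

(** The distinguished positive weight [w0] keeps the total mass positive while the others may
    vanish. Each induction step mixes one new point with the previous barycentre. *)
Lemma econvex_jensen (R : realType) n (g : 'rV[R]_n -> \bar R) (I : Type)
    (r : seq I) (Q : pred I) (w : I -> R) (y : I -> 'rV[R]_n) w0 y0 :
  proper_fun g -> econvex g -> 0 < w0 -> g y0 \is a fin_num ->
  (forall i, Q i -> 0 <= w i) -> (forall i, Q i -> g (y i) \is a fin_num) ->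
  let S := \sum_(i <- r | Q i) w i + w0 in
  let c := S^-1 *: (\sum_(i <- r | Q i) w i *: y i + w0 *: y0) in
  [/\ 0 < S, g c \is a fin_num &
   S * fine (g c) <= \sum_(i <- r | Q i) w i * fine (g (y i)) + w0 * fine (g y0)].
Proof.
move=> gp gc w00 y0f wge yf; elim: r => [|i r IH] /=.
  rewrite !big_nil !add0r scalerA mulVf ?gt_eqF// scale1r; split => //.
rewrite !big_cons; case: ifPn => // Qi.
move: IH; set s := \sum_(j <- r | Q j) w j; set v := \sum_(j <- r | Q j) w j *: y j.
set G := \sum_(j <- r | Q j) _; move=> /= [S0 cf cle].
have wi := wge _ Qi; have S1 : 0 < w i + s + w0 by rewrite -addrA ltr_wpDl.
have t0 : 0 <= w i / (w i + s + w0) by rewrite divr_ge0// ltW.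
have t1 : w i / (w i + s + w0) <= 1.
  by rewrite ler_pdivrMr// mul1r -addrA lerDl ltW.
have [] := econvex_fine gp gc (yf _ Qi) cf t0 t1; rewrite -segmentE.
have e1 : 1 - w i / (w i + s + w0) = (s + w0) / (w i + s + w0).
  by field; rewrite gt_eqF.
have -> : w i / (w i + s + w0) *: y i
    + (1 - w i / (w i + s + w0)) *: ((s + w0)^-1 *: (v + w0 *: y0))
  = (w i + s + w0)^-1 *: (w i *: y i + v + w0 *: y0).
  rewrite e1 scalerA mulrAC divff ?gt_eqF// mul1r -[w i *: y i + _ + _]addrA.
  by rewrite [in RHS]scalerDr scalerA (mulrC _^-1).
rewrite e1 => pf ple; split => //.
have h : (w i + s + w0) * (w i / (w i + s + w0) * fine (g (y i)) +
  (s + w0) / (w i + s + w0) * fine (g ((s + w0)^-1 *: (v + w0 *: y0))))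
  = w i * fine (g (y i)) + (s + w0) * fine (g ((s + w0)^-1 *: (v + w0 *: y0))).
  by field; rewrite gt_eqF.
have := ler_wpM2l (ltW S1) ple; rewrite h => /le_trans; apply.
by rewrite -addrA lerD2l.
Qed.

(** * Lipschitz continuity on compact sets *)

Lemma enorm_near (R : realType) n (p : 'rV[R]_n) (d : R) : 0 < d ->
  nbhs p [set q | enorm (q - p) < d].
Proof.
move=> d0; have n0 : 0 < (n%:R + 1 : R) by rewrite ltr_wpDl.
apply/nbhs_ballP; exists (d / (n%:R + 1)); first by rewrite /= divr_gt0.
move=> q; rewrite -ball_normE /= ltr_pdivlMr// => h; rewrite enormB.
by apply: (le_lt_trans (enorm_le_norm _)); apply: le_lt_trans h; rewrite mulrC ler_wpM2l// lerDl.
Qed.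

(** Compactness of V x V makes a constant that works near each pair uniform. Near the diagonal a
    local modulus serves; away from it the increment of [F] is bounded and the distance is bounded
    below. *)
Lemma lipschitz_compact (R : realType) n (F : 'rV[R]_n -> 'rV[R]_n) V :
  locally_lipschitz F -> compact V -> exists L, lipschitz_modulus F V L.
Proof.
move=> Fl Vc; have := compact_setX Vc Vc; move/compact_near_coveringP.
move=> /(_ R +oo (fun L z => enorm (F z.1 - F z.2) <= L * enorm (z.1 - z.2)) _)[].
  move=> [x y] [/= Vx Vy].
  have [U xU [L1 [L10 FU]]] := Fl x; have [W yW [L2 [L20 FW]]] := Fl y.
  have [xy|xy] := eqVneq x y.
    exists ((U `*` U), [set L | L1 <= L]).
      split; last by apply: nbhs_pinfty_ge; rewrite num_real.
      by exists (U, U) => //; split => //=; rewrite -xy.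
    move=> [[z1 z2] L] /= [[Uz1 Uz2] L1L].
    by apply: (le_trans (FU _ _ Uz1 Uz2)); rewrite ler_wpM2r ?enorm_ge0.
  pose r := enorm (x - y).
  have r0 : 0 < r.
    rewrite lt_def enorm_ge0 andbT; apply: contra xy => /eqP/enorm_eq0/eqP.
    by rewrite subr_eq0.
  (* Moving each point by less than r/4 keeps the pair at distance at least r/2. *)
  have r4 : 0 < r / 4 by lra.
  have Ux := nbhs_singleton xU; have Wy := nbhs_singleton yW.
  pose M := L1 * (r / 4) + enorm (F x - F y) + L2 * (r / 4).
  exists ((U `&` [set q | enorm (q - x) < r / 4]) `*`
          (W `&` [set q | enorm (q - y) < r / 4]), [set L | M / (r / 2) <= L]).
    split; last by apply: nbhs_pinfty_ge; rewrite num_real.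
    exists (U `&` [set q | enorm (q - x) < r / 4], W `&` [set q | enorm (q - y) < r / 4]) => //.
    by split; apply: filterI => //; exact: enorm_near.
  move=> [[z1 z2] L] /= [[[Uz1 z1x] [Wz2 z2y]] ML].
  have h1 : enorm (F z1 - F z2) <= M.
    have -> : F z1 - F z2 = (F z1 - F x) + (F x - F y) + (F y - F z2).
      by rewrite !addrA !subrK.
    apply: (le_trans (ler_enormD _ _)); rewrite lerD//.
      rewrite (le_trans (ler_enormD _ _))// lerD2r (le_trans (FU _ _ Uz1 Ux))//.
      by rewrite ler_wpM2l// ltW.
    rewrite (le_trans (FW _ _ Wy Wz2))// ler_wpM2l// enormB ltW//.
  have h2 : r / 2 <= enorm (z1 - z2).
    have : r <= enorm (x - z1) + enorm (z1 - z2) + enorm (z2 - y).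
      rewrite /r; have -> : x - y = (x - z1) + (z1 - z2) + (z2 - y).
        by rewrite !addrA !subrK.
      by rewrite (le_trans (ler_enormD _ _))// lerD2r ler_enormD.
    by rewrite (enormB x); lra.
  have M0 : 0 <= M by rewrite (le_trans _ h1) ?enorm_ge0.
  apply: (le_trans h1); apply: (@le_trans _ _ (M / (r / 2) * enorm (z1 - z2))).
    rewrite -[leLHS](@divfK _ (r / 2)); last by lra.
    by rewrite ler_wpM2l// divr_ge0//; lra.
  by rewrite ler_wpM2r ?enorm_ge0.
move=> N [Nr hN]; have L0 : N < Num.max (N + 1) 0 by rewrite lt_max ltrDl ltr01.
exists (Num.max (N + 1) 0); split; first by rewrite le_max lexx orbT.
by move=> x y Vx Vy; apply: (hN _ L0 (x, y)).
Qed.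

Lemma enorm_bounded (R : realType) n (I : Type) (x : I -> 'rV[R]_n) p (M : R) :
  (forall i, enorm (x i - p) <= M) -> bounded_set (range x).
Proof.
move=> h; exists (M + `|p|); split; first exact: num_real.
move=> N MN _ [i _ <-] /=; apply: le_trans (ltW MN).
rewrite -[x i](subrK p) (le_trans (ler_normD _ _))// lerD2r.
by rewrite (le_trans (norm_le_enorm _)).
Qed.

Lemma closed_ball_cover (R : realType) n (x : nat -> 'rV[R]_n) :
  bounded_set (range x) -> exists V, compact_convex_cover x V.
Proof.
(* Boundedness only provides bounds strictly above M, hence the radius M + 1. *)
move=> [M [_ hM]]; pose V := [set q : 'rV[R]_n | `|q| <= M + 1].
have N0 : M < M + 1 by rewrite ltrDl.
exists V; split.
- apply: bounded_closed_compact.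
    exists (M + 1); split; first exact: num_real.
    by move=> N MN q /le_trans; apply; exact: ltW.
  have -> : V = [set q | `|q| \in [set r : R | r <= M + 1]%classic].
    by apply/seteqP; split=> q; rewrite /= inE.
  rewrite (_ : [set _ | _] = Num.norm @^-1` [set r : R | r <= M + 1]); last first.
    by apply/seteqP; split=> q /=; rewrite inE.
  by apply: closed_comp; [move=> q _; exact: norm_continuous|exact: closed_le].
- move=> p q t; rewrite !inE /V /= => pM qM.
  change (is_true (`|t%:inum *: (p : 'rV[R]_n) + (1 - t%:inum) *: q| <= M + 1)).
  have t0 : 0 <= t%:inum by [].
  have t1 : 0 <= 1 - t%:inum by rewrite subr_ge0.
  rewrite (le_trans (ler_normD _ _))// !normrZ !ger0_norm//.
  have := ler_wpM2l t0 pM; have := ler_wpM2l t1 qM; lra.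
- by move=> k; apply: hM => //; exists k.
Qed.

(** * Runs of the algorithm *)

Section Run.
Context (R : realType) (n : nat).
Context (F : 'rV[R]_n -> 'rV[R]_n) (g : 'rV[R]_n -> \bar R) (a cs L0 : R).
Context (x : nat -> 'rV[R]_n) (gam rho : nat -> R).
Context (F_mono : monotone_map F) (F_lip : locally_lipschitz F).
Context (g_proper : proper_fun g) (g_convex : econvex g).
Context (g_lsc : lower_semicontinuous g).
Context (a_ge1 : 1 <= a) (a_le2 : a <= 2).
Context (cs_gt0 : 0 < cs) (cs_le : cs <= c_par a).
Context (run : adaFRBplus F g a cs L0 x gam rho).

Local Notation P := (dF F x).
Local Notation D := (dX x).
Local Notation kap := (kappa F x).
Local Notation ta := (tau F a x gam rho).

(** * Bounds on kappa_k, tau_k and beta_k *)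

Lemma eps_gt0 : 0 < eps_par a.
Proof. exact: c_par_gt0. Qed.

Lemma kappa_ge0 k : 0 <= kap k.
Proof.
by rewrite divr_ge0 ?mulr_ge0 ?enorm_ge0// /negpart le_max lexx orbT.
Qed.

Lemma kappa_le1 k : kap k <= 1.
Proof.
have PP0 : 0 <= enorm (P k) * enorm (P k.-1) by rewrite mulr_ge0 ?enorm_ge0.
rewrite /kappa; move: PP0; rewrite le_eqVlt => /predU1P[<-|PP0].
  by rewrite invr0 mulr0.
rewrite ler_pdivrMr// mul1r /negpart ge_max (ltW PP0) andbT.
by apply: le_trans (dotp_le_enorm _ _); rewrite -normrN ler_norm.
Qed.

Lemma kappa_ineq k :
  - dotp (P k) (P k.-1) <= kap k * (enorm (P k) * enorm (P k.-1)).
Proof.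
have PP0 : 0 <= enorm (P k) * enorm (P k.-1) by rewrite mulr_ge0 ?enorm_ge0.
rewrite /kappa; move: PP0; rewrite le_eqVlt => /predU1P[PP0|PP0].
  rewrite -PP0 mulr0 PP0; apply: le_trans (dotp_le_enorm _ _).
  by rewrite -normrN ler_norm.
by rewrite divfK ?gt_eqF// /negpart le_max lexx.
Qed.

(** Young's inequality: the difference of the two sides is a square divided by 2 eps rho_k gam_k.
    With Cauchy-Schwarz it gives tau_k <= 1. *)
Lemma tau_den k : 0 < gam k -> 0 < rho k ->
  enorm (D k) * enorm (P k.-1) <=
  eps_par a / (2 * gam k * rho k) * enorm (D k) ^+ 2
   + rho k * gam k / (2 * eps_par a) * enorm (P k.-1) ^+ 2.
Proof.
move=> g0 r0; have e0 := eps_gt0; move: (eps_par a) e0 => e e0.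
rewrite -subr_ge0.
have -> : e / (2 * gam k * rho k) * enorm (D k) ^+ 2
   + rho k * gam k / (2 * e) * enorm (P k.-1) ^+ 2 - enorm (D k) * enorm (P k.-1)
  = (e * enorm (D k) - rho k * gam k * enorm (P k.-1)) ^+ 2 / (2 * e * (rho k * gam k)).
  by field; lra.
by rewrite divr_ge0 ?sqr_ge0// ?mulr_ge0// ltW.
Qed.

Lemma tau_le1 k : 0 < gam k -> 0 < rho k -> ta k <= 1.
Proof.
move=> g0 r0; have := tau_den g0 r0; rewrite /tau.
set den := (X in _ <= X -> _) => hd; rewrite -[X in _ / X]/den.
have hn := le_trans (ler_norm _) (dotp_le_enorm (D k) (P k.-1)).
have : 0 <= den by apply: le_trans hd; rewrite mulr_ge0 ?enorm_ge0.
rewrite le_eqVlt => /predU1P[<-|d0]; first by rewrite invr0 mulr0.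
by rewrite ler_pdivrMr// mul1r (le_trans hn).
Qed.

Lemma tau_eq k : 0 < gam k -> 0 < rho k ->
  gam k * rho k * dotp (D k) (P k.-1) =
  ta k * (eps_par a / 2 * dotp (D k) (D k)
          + (rho k * gam k) ^+ 2 / (2 * eps_par a) * dotp (P k.-1) (P k.-1)).
Proof.
move=> g0 r0; have e0 := eps_gt0; have := tau_den g0 r0; rewrite /tau.
set den := (X in _ <= X -> _) => hd; rewrite -[X in _ / X]/den.
have -> : eps_par a / 2 * dotp (D k) (D k)
   + (rho k * gam k) ^+ 2 / (2 * eps_par a) * dotp (P k.-1) (P k.-1)
  = gam k * rho k * den.
  by rewrite /den !enorm_sqr; move: (eps_par a) e0 => e e0; field; lra.
(* When the denominator vanishes the quotient is 0 by convention, but so is the inner product. *)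
have [d0|d0] := eqVneq den 0; last by rewrite mulrCA divfK.
have -> : dotp (D k) (P k.-1) = 0; last by rewrite mul0r mul0r mulr0.
apply/eqP; rewrite -normr_le0 (le_trans (dotp_le_enorm _ _))//.
by rewrite (le_trans hd) ?d0.
Qed.

Local Notation sg := ((2 - a) / (2 * a * eps_par a)).

Lemma sg_ge0 : 0 <= sg.
Proof.
have a1 := a_ge1; have a2 := a_le2.
have := eps_gt0; move: (eps_par a) => e e0.
by rewrite divr_ge0 ?mulr_ge0//; lra.
Qed.

Lemma beta_num_gt0 : 0 < 1 + (mu_par a)^-1 + sg.
Proof.
have := sg_ge0; have : 0 < (mu_par a)^-1 by rewrite invr_gt0 mu_par_gt0.
lra.
Qed.

(** The numerator under the root is the denominator evaluated at kappa = tau = 1, its largest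
    value. *)
Lemma beta_root_ge1 k : ta k <= 1 -> (1 <= beta_root a (kap k) (ta k))%E.
Proof.
move=> t1; rewrite /beta_root.
case: ifPn => [_|]; first exact: leey.
rewrite -ltNge => d0; rewrite lee_fin -[leLHS]sqrtr1 ler_wsqrtr// ler_pdivlMr// mul1r.
have m0 : 0 <= (mu_par a)^-1 by rewrite invr_ge0 ltW// mu_par_gt0.
have := ler_wpM2l m0 (kappa_le1 k); have := ler_wpM2r sg_ge0 t1; lra.
Qed.

Lemma beta_ge1 k : 0 < gam k -> 0 < rho k -> (1 <= beta F a x gam rho k)%E.
Proof.
move=> g0 r0; rewrite /beta le_min beta_root_ge1 ?rho_tilde_ge1//.
exact: tau_le1.
Qed.

(** * Positivity of the stepsizes and consequences of their update *)

Lemma Lk_ge0 k : 0 <= Lk F L0 x k.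
Proof.
rewrite /Lk; case: ifP => _; first by rewrite ltW// (ada_L0 run).
by rewrite divr_ge0 ?enorm_ge0.
Qed.

(** Both signs go through one induction, because beta_k >= 1 relies on tau_k <= 1, which needs
    both. *)
Lemma gam_rho_gt0 k : 0 < gam k /\ 0 < rho k.
Proof.
have a1 := a_ge1; have a2 := a_le2.
elim: k => [|k [g0 r0]]; first by rewrite (ada_gam0 run) (ada_rho0 run).
suff g1 : 0 < gam k.+1 by rewrite (ada_rho run) divr_gt0.
rewrite -lte_fin (ada_gam run) !lt_min; apply/and3P; split.
- rewrite lte_fin mulr_gt0// sqrtr_gt0 addr_gt0// invr_gt0; lra.
- apply: (@lt_le_trans _ _ (1 * (gam k)%:E)%E); first by rewrite mul1e lte_fin.
  by rewrite lee_wpmul2r ?beta_ge1// lee_fin ltW.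
- rewrite /ediv; case: eqP => [//|/eqP l0]; first by rewrite ltry.
  by rewrite lte_fin divr_gt0// lt_def l0 Lk_ge0.
Qed.

Lemma gam_gt0 k : 0 < gam k.
Proof. by have [] := gam_rho_gt0 k. Qed.

Lemma rho_gt0 k : 0 < rho k.
Proof. by have [] := gam_rho_gt0 k. Qed.

Lemma gamS k : gam k.+1 = rho k.+1 * gam k.
Proof. by rewrite (ada_rho run) divfK// gt_eqF// gam_gt0. Qed.

Lemma gamS_le k : [/\ gam k.+1 <= gam k * Num.sqrt (a^-1 + rho k),
  ((gam k.+1)%:E <= beta F a x gam rho k * (gam k)%:E)%E &
  ((gam k.+1)%:E <= ediv cs (Lk F L0 x k))%E].
Proof.
have := lexx (gam k.+1)%:E; rewrite {2}(ada_gam run) !le_min lee_fin.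
by move=> /and3P[].
Qed.

(** The alternatives say which term attains the minimum; for the second term only beta_k >= 1 is
    retained, so that the stepsize does not decrease. *)
Lemma gamS_cases k : [\/ gam k.+1 = gam k * Num.sqrt (a^-1 + rho k),
  (1 <= rho k.+1) | ((gam k.+1)%:E = ediv cs (Lk F L0 x k))%E].
Proof.
have := ada_gam run k; rewrite /Order.min.
case: ifP => _; first by case=> ->; constructor 1.
case: ifP => _ e; last by constructor 3.
constructor 2; rewrite (ada_rho run) ler_pdivlMr ?gam_gt0// mul1r.
rewrite -lee_fin e -[leLHS]mul1e lee_wpmul2r//.
  by rewrite lee_fin ltW ?gam_gt0.
by rewrite beta_ge1 ?gam_gt0 ?rho_gt0.
Qed.

Lemma rho_sqr_le k : rho k.+1 ^+ 2 <= a^-1 + rho k.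
Proof.
have a1 := a_ge1; have a2 := a_le2.
have [h _ _] := gamS_le k; have s0 : 0 <= a^-1 + rho k.
  by rewrite addr_ge0 ?invr_ge0 ?ltW ?rho_gt0//; lra.
rewrite -(sqr_sqrtr s0) lerXn2r ?nnegrE ?sqrtr_ge0//; first by rewrite ltW ?rho_gt0.
by rewrite -(ler_pM2r (gam_gt0 k)) -gamS mulrC (le_trans h)// mulrC.
Qed.

(** By induction rho_{k+1}^2 <= 1/a + rho_k <= 3 < 4. *)
Lemma rho_le2 k : rho k <= 2.
Proof.
have a1 := a_ge1; have a2 := a_le2.
elim: k => [|k IH]; first by rewrite (ada_rho0 run); lra.
have ai : a^-1 <= 1 by rewrite invf_le1//; lra.
rewrite leNgt; apply/negP => h; have := rho_sqr_le k; apply/negP; rewrite -ltNge.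
nra.
Qed.

Lemma erg_weight_ge0 k : 0 <= erg_weight a gam rho k.
Proof.
have a1 := a_ge1; have a2 := a_le2.
rewrite /erg_weight ?mulr_ge0 ?subr_ge0 ?rho_sqr_le// ?ltW ?gam_gt0//; lra.
Qed.

(** This is the weight of V_{k-1} in U_k minus the weight that the one-step estimate leaves on
    V_{k-1}. *)
Lemma erg_weightE k :
  erg_weight a gam rho k =
  (1 + a * rho k) * gam k - a * rho k.+1 ^+ 2 * gam k.
Proof.
by rewrite /erg_weight; field; rewrite gt_eqF// (lt_le_trans ltr01).
Qed.

(** The third term of the update is exactly this bound. In the degenerate cases k = 0, D^k = 0 and
    L_k = 0 the increment of [F] is 0. *)
Lemma gam_dF_le k : gam k.+1 * enorm (P k) <= cs * enorm (D k).
Proof.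
case: k => [|k]; first by rewrite /dF /dX !subrr !enorm0 !mulr0.
have [_ _] := gamS_le k.+1; rewrite /ediv.
have [d0|d0] := eqVneq (enorm (D k.+1)) 0.
  move/enorm_eq0: (d0); rewrite /dX /dF /= => /subr0_eq ->.
  by rewrite !subrr !enorm0 !mulr0.
have dp : 0 < enorm (D k.+1) by rewrite lt_def d0 enorm_ge0.
case: eqP => [l0 _|/eqP l0].
  have -> : enorm (P k.+1) = 0; last by rewrite mulr0 mulr_ge0 ?enorm_ge0// ltW.
  by move: l0; rewrite /Lk /= => /eqP; rewrite mulf_eq0 invr_eq0 (negPf d0) orbF => /eqP.
have lp : 0 < Lk F L0 x k.+1 by rewrite lt_def l0 Lk_ge0.
rewrite lee_fin ler_pdivlMr// => h.
have -> : enorm (P k.+1) = Lk F L0 x k.+1 * enorm (D k.+1) by rewrite /Lk divfK.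
by rewrite mulrA ler_pM2r.
Qed.

Lemma rhoS_le_beta k : ((rho k.+1)%:E <= beta F a x gam rho k)%E.
Proof.
have [_ + _] := gamS_le k.
by rewrite gamS EFinM lee_pmul2r ?lte_fin ?gam_gt0.
Qed.

Lemma rhoS_quad k : 0 <= quad a (kap k) (ta k) (rho k.+1).
Proof.
have := rhoS_le_beta k; rewrite /beta le_min => /andP[_ h].
by apply: quad_ge0 => //; rewrite ?kappa_ge0 ?kappa_le1 ?tau_le1 ?gam_gt0// ?ltW ?rho_gt0.
Qed.

Lemma rhoS_root k :
  rho k.+1 ^+ 2 * (1 + (mu_par a)^-1 * kap k + ta k * sg)
    <= 1 + (mu_par a)^-1 + sg.
Proof.
have := rhoS_le_beta k; rewrite /beta le_min => /andP[+ _].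
rewrite /beta_root; have num0 := beta_num_gt0.
case: ifPn => [d0 _|].
  by rewrite (le_trans _ (ltW num0))// mulr_ge0_le0// sqr_ge0.
rewrite -ltNge lee_fin => d0 h; rewrite -ler_pdivlMr//.
rewrite -[leRHS]sqr_sqrtr; last by rewrite divr_ge0// ltW.
rewrite lerXn2r ?nnegrE ?sqrtr_ge0//.
by rewrite ltW// rho_gt0.
Qed.

(** * Descent of the Lyapunov function and telescoping *)

Lemma x_prox_ineq k z : g z \is a fin_num ->
  gam k.+1 * fine (g (x k.+1)) + dotp (- D k.+1 -
     gam k.+1 *: (F (x k) + (a * rho k.+1) *: P k)) (z - x k.+1)
  <= gam k.+1 * fine (g z).
Proof.
move=> zf; have := prox_ineq g_proper g_convex (gam_gt0 k.+1) (ada_x run k) zf.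
suff -> : - D k.+1 - gam k.+1 *: (F (x k) + (a * rho k.+1) *: P k)
  = x k - gam k.+1 *: (F (x k) + (a * rho k.+1) *: (F (x k) - F (x k.-1))) - x k.+1 by [].
by rewrite /dX /= opprB addrAC.
Qed.

Lemma gx_fin k : g (x k.+1) \is a fin_num.
Proof. exact: prox_fin (ada_x run k). Qed.

(** [gapr] and [lyapr] are real-valued versions, meaningful only where [g] is finite: [fine] sends
    an infinite value to 0, and [x 0] may lie outside dom g. *)
Definition gapr k z := fine (g (x k)) - fine (g z) + dotp (F (x k)) (x k - z).

Definition lyapr k z :=
  2^-1 * enorm (x k - z) ^+ 2 + 2^-1 * enorm (x k - x k.-1) ^+ 2
  + lambda_par a * (gam k * rho k) ^+ 2 / 2 * enorm (F (x k.-1) - F (x k.-2)) ^+ 2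
  + (1 + a * rho k) * gam k * gapr k.-1 z.

Lemma lyapr_step k z : g (x k) \is a fin_num -> g z \is a fin_num ->
  lyapr k.+2 z + erg_weight a gam rho k.+1 * gapr k z
    + (c_par a ^+ 2 - cs ^+ 2) * enorm (D k.+1) ^+ 2 <= lyapr k.+1 z.
Proof.
have a1 := a_ge1; have a2 := a_le2.
move=> xf zf.
have fE : F (x k) = F (x k.+1) - P k.+1 by rewrite /dF /= subKr.
have DE : x k - x k.+1 = - D k.+1 by rewrite /dX /= opprB.
have EE : x k.+2 - x k.+1 = D k.+2 by [].
have EE' : x k.+1 - x k.+2 = - D k.+2 by rewrite /dX /= opprB.
have wE : x k.+2 - z = (x k.+1 - z) + D k.+2 by rewrite /dX /= [RHS]addrC subrKA.
have zE : z - x k.+2 = - ((x k.+1 - z) + D k.+2) by rewrite -wE opprB.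
have wE' : x k - z = (x k.+1 - z) - D k.+1.
  by rewrite /dX /= opprB [RHS]addrC subrKA.
(* The proximal point [x k.+1] is tested at [x k.+2] and [x k], then [x k.+2] at [z] and
   [x k.+1]. *)
have s2 := x_prox_ineq k (gx_fin k.+1).
have s3 := x_prox_ineq k xf.
have s1 := x_prox_ineq k.+1 zf.
have s4 := x_prox_ineq k.+1 (gx_fin k).
move: s1 s2 s3 s4; rewrite fE DE EE EE' zE (gamS k.+1) => s1 s2 s3 s4.
have a0 : 0 <= a by lra.
have step := reflected_step a0 (ltW (rho_gt0 _)) s2 s3 s1 s4.
have hF : (rho k.+2 * gam k.+1) ^+ 2 * dotp (P k.+1) (P k.+1)
    <= cs ^+ 2 * dotp (D k.+1) (D k.+1).
  rewrite -gamS -!enorm_sqr -!exprMn lerXn2r ?nnegrE ?gam_dF_le//.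
    by rewrite mulr_ge0 ?enorm_ge0// ltW ?gam_gt0.
  by rewrite mulr_ge0 ?enorm_ge0// ltW.
have mixed := mixed_terms_le a_ge1 a_le2 (ltW (gam_gt0 k.+1)) (ltW (rho_gt0 k.+2))
  (ltW (rho_gt0 k.+1)) (kappa_ge0 k.+1) (ltW cs_gt0) cs_le
  (dotp_ge0 (D k.+1))
  (enorm_sqr (P k.+1)) (enorm_sqr (P k)) (F_mono (x k.+1) (x k))
  (kappa_ineq k.+1) (tau_eq (gam_gt0 k.+1) (rho_gt0 k.+1)) hF
  (rhoS_root k.+1) (rhoS_quad k.+1).
move: step mixed; rewrite /lyapr /gapr /= -/(D k.+2) -/(D k.+1) -/(P k.+1) -/(P k).
rewrite wE wE' fE (gamS k.+1) erg_weightE !enorm_sqr.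
move: (P k.+1) (P k) (D k.+2) (D k.+1) (x k.+1 - z) => u v e d w.
rewrite !dotpE (dotpC u d) (dotpC v d) (dotpC v u).
lra.
Qed.

(** Monotonicity replaces F(x^k) by F(z), which makes the linear term affine in x^k, as Jensen's
    inequality and Minty's lemma require. *)
Lemma gapr_mono k z :
  fine (g (x k)) - fine (g z) + dotp (F z) (x k - z) <= gapr k z.
Proof.
rewrite lerD2l -subr_ge0; have := F_mono (x k) z.
by rewrite dotpDl dotpNl.
Qed.

Lemma gapr_ge0 k z : g (x k) \is a fin_num -> zer (opT F g) z -> 0 <= gapr k z.
Proof.
move=> xf zz; apply: le_trans (gapr_mono k z).
exact: zer_ineq.
Qed.

Lemma lyapr_weight_ge0 k : 0 <= (1 + a * rho k) * gam k.
Proof.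
have a0 : 0 <= a by rewrite (le_trans _ a_ge1).
by rewrite mulr_ge0 ?addr_ge0 ?mulr_ge0// ltW ?gam_gt0 ?rho_gt0.
Qed.

Lemma lyapr_ge k z :
  2^-1 * enorm (x k - z) ^+ 2 + (1 + a * rho k) * gam k * gapr k.-1 z <= lyapr k z.
Proof.
have l0 := lambda_par_ge0 a_ge1 a_le2.
rewrite /lyapr; move: (lambda_par a) l0 => l l0.
rewrite lerD2r -addrA lerDl addr_ge0//; first by rewrite mulr_ge0 ?sqr_ge0.
by rewrite mulr_ge0 ?sqr_ge0// divr_ge0// mulr_ge0 ?sqr_ge0.
Qed.

Lemma lyapr_ge0 k z : g (x k) \is a fin_num -> zer (opT F g) z ->
  0 <= lyapr k.+1 z.
Proof.
move=> xf zz; apply: le_trans (lyapr_ge k.+1 z).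
by rewrite addr_ge0// mulr_ge0 ?sqr_ge0 ?invr_ge0 ?lyapr_weight_ge0// gapr_ge0.
Qed.

Lemma slack_ge0 : 0 <= c_par a ^+ 2 - cs ^+ 2.
Proof. by rewrite subr_ge0 lerXn2r// nnegrE ltW// (lt_le_trans cs_gt0). Qed.

(** The starting index is free because g(x^0) may be infinite: m = 1 is always admissible, m = 0
    only if x^0 is in dom g. *)
Lemma lyapr_telescope m K z : g (x m) \is a fin_num -> g z \is a fin_num ->
  lyapr (m + K).+1 z
    + \sum_(m <= i < m + K) erg_weight a gam rho i.+1 * gapr i z <= lyapr m.+1 z.
Proof.
move=> xm zf; elim: K => [|K IH].
  by rewrite addn0 big_geq// addr0.
rewrite addnS big_nat_recr ?leq_addr//=.
have xf : g (x (m + K)%N) \is a fin_num by case: K {IH} => [|K]; rewrite ?addn0 ?addnS ?gx_fin.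
have := lyapr_step xf zf; have := mulr_ge0 slack_ge0 (sqr_ge0 (enorm (D (m + K).+1))).
by move: IH; move: (\sum_(_ <= _ < _) _) => s; lra.
Qed.

Lemma lyapr_sum m N z : g (x m) \is a fin_num -> g z \is a fin_num ->
  (m <= N)%N ->
  \sum_(m <= i < N) erg_weight a gam rho i.+1 * gapr i z
    + (1 + a * rho N.+1) * gam N.+1 * gapr N z <= lyapr m.+1 z.
Proof.
move=> xm zf /subnKC <-; apply: le_trans (lyapr_telescope (N - m) xm zf).
rewrite addrC lerD2r; apply: le_trans (lyapr_ge _ _).
by rewrite lerDr mulr_ge0 ?sqr_ge0 ?invr_ge0.
Qed.

(** As rho_{i+2} gam_{i+1} = gam_{i+2}, each ergodic weight is gam_{i+1} plus a telescoping
    difference of a rho_j gam_j. The total mass thus dominates the sum of the stepsizes. *)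
Lemma weight_sum m N : (m <= N)%N ->
  \sum_(m <= i < N) erg_weight a gam rho i.+1 + (1 + a * rho N.+1) * gam N.+1
  = \sum_(m <= i < N.+1) gam i.+1 + a * rho m.+1 * gam m.+1.
Proof.
elim: N => [|N IH].
  by rewrite leqn0 => /eqP ->; rewrite big_geq// big_nat1; lra.
rewrite leq_eqVlt => /predU1P[->|].
  by rewrite big_geq// big_nat1; lra.
rewrite ltnS => mN; rewrite big_nat_recr//= [in RHS]big_nat_recr//=; last exact: leqW.
have := IH mN; rewrite erg_weightE (gamS N.+1).
move: (\sum_(_ <= _ < _) _) => s1; move: (\sum_(_ <= _ < _) _) => s2; lra.
Qed.

Lemma gap_average m N z v : g (x m) \is a fin_num -> g z \is a fin_num ->
  (m <= N)%N -> (forall i, (m <= i <= N)%N -> v <= gapr i z) -> 0 <= v ->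
  v * \sum_(m <= i < N.+1) gam i.+1 <= lyapr m.+1 z.
Proof.
move=> xm zf mN hv v0; apply: le_trans (lyapr_sum xm zf mN).
have a0 : 0 <= a by rewrite (le_trans _ a_ge1).
apply: (@le_trans _ _ (v * (\sum_(m <= i < N) erg_weight a gam rho i.+1
   + (1 + a * rho N.+1) * gam N.+1))).
  rewrite weight_sum// ler_wpM2l// lerDl mulr_ge0 ?mulr_ge0// ltW ?gam_gt0 ?rho_gt0//.
rewrite mulrDr mulr_sumr lerD//.
  apply: ler_sum_nat => i /andP[mi iN]; rewrite mulrC ler_wpM2l ?erg_weight_ge0// hv//.
  by rewrite mi ltnW.
by rewrite mulrC ler_wpM2l ?lyapr_weight_ge0// hv// mN leqnn.
Qed.

Lemma lyapr_anti k l z : g (x k) \is a fin_num -> zer (opT F g) z ->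
  (k <= l)%N -> lyapr l.+1 z <= lyapr k.+1 z.
Proof.
move=> xf zz /subnKC <-; have zf := zer_fin g_proper zz.
apply: le_trans (lyapr_telescope (l - k) xf zf); rewrite lerDl.
rewrite big_nat_cond sumr_ge0// => i /andP[/andP[i1 _] _].
rewrite mulr_ge0 ?erg_weight_ge0// gapr_ge0//.
by case: i i1 => [|i _]; [rewrite leqn0 => /eqP e; move: xf; rewrite e|exact: gx_fin].
Qed.

Lemma run_bounded z : zer (opT F g) z -> exists M, forall k, enorm (x k - z) <= M.
Proof.
(* U_2 is the first value involving only a gap at a proximal point; it controls x^k for k >= 2, and
   x^0 and x^1 are added by hand. *)
move=> zz; pose M := Num.sqrt (2 * lyapr 2 z).
exists (Num.max (enorm (x 0%N - z)) (Num.max (enorm (x 1%N - z)) M)) => -[|[|k]].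
- by rewrite le_max lexx.
- by rewrite !le_max lexx !orbT.
rewrite !le_max; apply/orP; right; apply/orP; right.
rewrite -(ger0_norm (enorm_ge0 _)) -sqrtr_sqr ler_wsqrtr//.
have := lyapr_anti (gx_fin 0) zz (ltn0Sn k); have := lyapr_ge k.+2 z.
have : 0 <= (1 + a * rho k.+2) * gam k.+2 * gapr k.+2.-1 z.
  by rewrite mulr_ge0 ?lyapr_weight_ge0// gapr_ge0// gx_fin.
lra.
Qed.

(** * Lower bound on the stepsizes *)

Lemma Lk_le L k : 0 <= L -> (forall j, enorm (P j) <= L * enorm (D j)) ->
  Lk F L0 x k.+1 <= L.
Proof.
move=> L0' h; rewrite /Lk /=; have [->|d0] := eqVneq (enorm (D k.+1)) 0.
  by rewrite invr0 mulr0.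
by rewrite ler_pdivrMr// lt_def d0 enorm_ge0.
Qed.

(* A decrease caused by the first term of the update can only follow one
   caused by [cs / Lk]: if [rho k >= 1 - 1 / a] then [1 / a + rho k >= 1], and
   the first term itself produces a ratio at least [1 / sqrt a >= 1 - 1 / a]. *)
Lemma gam_ge m L k : 0 <= L -> (forall j, enorm (P j) <= L * enorm (D j)) ->
  0 <= m -> m <= gam 0%N -> m * (Num.sqrt a * L) <= cs ->
  gam 0%N * L0 <= cs \/ L0 <= L -> m <= gam k.
Proof.
move=> Lge0 hL m0 mg mL hL0; have a1 := a_ge1; have a2 := a_le2.
have ap : 0 < a by lra.
have ai : 2^-1 <= a^-1 by rewrite lef_pV2 ?posrE//; lra.
have ai1 : a^-1 <= 1 by rewrite invf_le1.
have sa1 : 1 <= Num.sqrt a by rewrite -[leLHS]sqrtr1 ler_wsqrtr.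
have sai : Num.sqrt a * Num.sqrt a^-1 = 1.
  by rewrite -sqrtrM ?divff ?sqrtr1 ?gt_eqF// ltW.
have sai2 : 1 - a^-1 <= Num.sqrt a^-1.
  apply: (@le_trans _ _ 2^-1); first lra.
  rewrite -[leLHS]ger0_norm ?invr_ge0// -sqrtr_sqr ler_wsqrtr//; lra.
have samm : m <= Num.sqrt a * m by rewrite ler_peMl.
(* Induction invariant: either the ratio is large enough for the first term not to decrease the next
   stepsize, or gam_k has a spare factor sqrt a to pay for one decrease by at most 1 / sqrt a. *)
suff : (1 - a^-1 <= rho k /\ m <= gam k) \/ Num.sqrt a * m <= gam k.
  by case=> [[]//|]; exact: le_trans.
elim: k => [|k IH]; first by left; split => //; rewrite (ada_rho0 run); lra.
have mk : m <= gam k by case: IH => [[]//|]; exact: le_trans.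
have up : 1 <= rho k.+1 -> (1 - a^-1 <= rho k.+1 /\ m <= gam k.+1).
  move=> r1; split; first by lra.
  by rewrite (le_trans mk)// gamS ler_peMl// ltW ?gam_gt0.
have lk : Lk F L0 x k != 0 -> Lk F L0 x k <= L ->
    (gam k.+1)%:E = ediv cs (Lk F L0 x k) -> Num.sqrt a * m <= gam k.+1.
  move=> l0 lL; rewrite /ediv (negPf l0) => -[->].
  rewrite ler_pdivlMr; last by rewrite lt_def l0 Lk_ge0.
  apply: le_trans mL; rewrite mulrA (mulrC m) ler_wpM2l// mulr_ge0//; lra.
have lN : (gam k.+1)%:E = ediv cs (Lk F L0 x k) -> Lk F L0 x k != 0.
  by rewrite /ediv; case: eqP.
have [gE|r1|gE] := gamS_cases k; [|by left; exact: up|].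
  have rE : rho k.+1 = Num.sqrt (a^-1 + rho k).
    by rewrite (ada_rho run) gE mulrC mulKf// gt_eqF ?gam_gt0.
  left; split.
    rewrite rE (le_trans sai2)// ler_wsqrtr// lerDl ltW ?rho_gt0//.
  rewrite gE; case: IH => [[rk _]|gk].
    rewrite (le_trans mk)// ler_peMr//; first by rewrite ltW ?gam_gt0.
    rewrite -[leLHS]sqrtr1 ler_wsqrtr//; lra.
  apply: (@le_trans _ _ (Num.sqrt a * m * Num.sqrt a^-1)).
    by rewrite mulrAC sai mul1r.
  rewrite ler_pM ?sqrtr_ge0// ?mulr_ge0//; last first.
    by rewrite ler_wsqrtr// lerDl ltW ?rho_gt0.
have l0 := lN gE; case: k {IH mk} up lk lN gE l0 => [|k] up lk lN gE l0; last first.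
  by right; apply: lk => //; exact: Lk_le.
(* At k = 0 the given [L0] replaces a Lipschitz quotient: either it is below L like the others, or c
   / L0 is at least gam_0 and the stepsize does not decrease. *)
case: hL0 => [h|h]; last by right; exact: lk.
left; apply: up; rewrite (ada_rho run) ler_pdivlMr ?gam_gt0// mul1r.
move: gE; rewrite /ediv (negPf l0) => -[->].
by rewrite ler_pdivlMr// (ada_L0 run).
Qed.

(** * Ergodic averages and their cluster points *)

Lemma ergodic_bounded : bounded_set (range x) -> bounded_set (range (ergodic a x gam rho)).
Proof.
move=> [M [_ hM]]; exists (M + 1); split; first exact: num_real.
move=> N MN _ [K _ <-] /=; apply: le_trans (ltW MN).
have M1 : M < M + 1 by rewrite ltrDl.
have xM k : `|x k| <= M + 1 by apply: (hM _ M1); exists k.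
rewrite /ergodic; set s := \sum_(_ <= _ < _) _; set w := _ * gam K.+1.
have s0 : 0 <= s by rewrite sumr_ge0// => i _; exact: erg_weight_ge0.
have w0 : 0 <= w := lyapr_weight_ge0 K.+1.
have sw0 : 0 <= s + w by rewrite addr_ge0.
rewrite normrZ ger0_norm ?invr_ge0//; have [e|S0] := eqVneq (s + w) 0.
  by rewrite e invr0 mul0r (le_trans _ (xM 0%N)).
rewrite mulrC ler_pdivrMr ?lt_def ?S0// (le_trans (ler_normD _ _))// mulrDr.
rewrite lerD//; last by rewrite normrZ ger0_norm// mulrC ler_wpM2r.
rewrite (le_trans (ler_norm_sum _ _ _))// mulr_sumr ler_sum// => i _.
by rewrite normrZ ger0_norm ?erg_weight_ge0// mulrC ler_wpM2r ?erg_weight_ge0.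
Qed.

(** Jensen's inequality is applied to the telescoped bound from x^1 on, and the total weight is
    replaced by the smaller sum of stepsizes. For [z] not a solution the signs of U_2(z) and of the
    left-hand side are unknown, hence the absolute value. *)
Lemma ergodic_gap K z : g z \is a fin_num ->
  g (ergodic a x gam rho K.+1) \is a fin_num /\
  (fine (g (ergodic a x gam rho K.+1)) - fine (g z)
    + dotp (F z) (ergodic a x gam rho K.+1 - z))
    * \sum_(1 <= i < K.+2) gam i.+1 <= `|lyapr 2 z|.
Proof.
move=> zf.
have w0 : 0 < (1 + a * rho K.+2) * gam K.+2.
  have a0 : 0 < a by rewrite (lt_le_trans _ a_ge1).
  by rewrite mulr_gt0 ?addr_gt0 ?mulr_gt0 ?gam_gt0 ?rho_gt0.
(* The filter [0 < i] changes no sum; it gives access to the finiteness of g(x^i). *)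
have [] := econvex_jensen (index_iota 1 K.+1) (Q := fun i => (0 < i)%N)
   (w := fun i => erg_weight a gam rho i.+1) (y := x) g_proper g_convex w0 (gx_fin K).
- by move=> i _; exact: erg_weight_ge0.
- by case=> // i _; exact: gx_fin.
have pos (T : nmodType) (f : nat -> T) :
    \sum_(i <- index_iota 1 K.+1 | (0 < i)%N) f i = \sum_(1 <= i < K.+1) f i.
  rewrite big_seq_cond [RHS]big_seq_cond; apply: eq_bigl => i.
  by rewrite mem_index_iota; case: i.
rewrite !pos.
have pE : (\sum_(1 <= i < K.+1) erg_weight a gam rho i.+1 + (1 + a * rho K.+2) * gam K.+2)^-1 *:
  (\sum_(1 <= i < K.+1) erg_weight a gam rho i.+1 *: x i
    + ((1 + a * rho K.+2) * gam K.+2) *: x K.+1)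
  = ergodic a x gam rho K.+1.
  by rewrite /ergodic !(big_add1 _ _ 1%N) /=.
rewrite pE.
set p := ergodic _ _ _ _ _; set S := _ + _ => S0 pf ple; split => //.
have Sp : S *: p = \sum_(1 <= i < K.+1) erg_weight a gam rho i.+1 *: x i
    + ((1 + a * rho K.+2) * gam K.+2) *: x K.+1.
  by rewrite -[p]pE scalerA divff ?gt_eqF// scale1r.
have SgL : \sum_(1 <= i < K.+2) gam i.+1 <= S.
  rewrite /S (weight_sum (ltn0Sn K)) lerDl mulr_ge0 ?mulr_ge0// ltW ?gam_gt0 ?rho_gt0//.
  by rewrite (lt_le_trans _ a_ge1).
set A := fine (g p) - _ + _.
have SA : S * A <= lyapr 2 z.
  apply: le_trans (lyapr_sum (gx_fin 0) zf (ltn0Sn K)).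
  pose G i := fine (g (x i)) - fine (g z) + dotp (F z) (x i - z).
  apply: (@le_trans _ _ (\sum_(1 <= i < K.+1) erg_weight a gam rho i.+1 * G i
      + (1 + a * rho K.+2) * gam K.+2 * G K.+1)); last first.
    rewrite lerD ?ler_wpM2l ?lyapr_weight_ge0 ?gapr_mono//.
    by apply: ler_sum => i _; rewrite ler_wpM2l ?erg_weight_ge0 ?gapr_mono.
  have -> : S * A = S * fine (g p) - S * fine (g z) + dotp (F z) (S *: p) - S * dotp (F z) z.
    by rewrite /A dotpDr dotpNr dotpZr; lra.
  have -> : \sum_(1 <= i < K.+1) erg_weight a gam rho i.+1 * G i
    = \sum_(1 <= i < K.+1) erg_weight a gam rho i.+1 * fine (g (x i))
      + \sum_(1 <= i < K.+1) erg_weight a gam rho i.+1 * dotp (F z) (x i)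
      - (\sum_(1 <= i < K.+1) erg_weight a gam rho i.+1) * (fine (g z) + dotp (F z) z).
    rewrite mulr_suml -sumrN -!big_split; apply: eq_bigr => i _ /=.
    by rewrite /G dotpDr dotpNr; lra.
  move: ple; rewrite Sp dotpDr dotpZr dotp_sumr.
  have -> : \sum_(1 <= i < K.+1) dotp (F z) (erg_weight a gam rho i.+1 *: x i)
    = \sum_(1 <= i < K.+1) erg_weight a gam rho i.+1 * dotp (F z) (x i).
    by apply: eq_bigr => i _; rewrite dotpZr.
  rewrite /G /S dotpDr dotpNr.
  move: (\sum_(_ <= _ < _) _) => s1; move: (\sum_(_ <= _ < _) _) => s2.
  move: (\sum_(_ <= _ < _) _) => s3; lra.
have [A0|A0] := leP A 0.
  rewrite (le_trans _ (normr_ge0 _))// mulr_le0_ge0// sumr_ge0// => i _.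
  by rewrite ltW ?gam_gt0.
by rewrite (le_trans _ (ler_norm _))// (le_trans _ SA)// mulrC ler_pM2r.
Qed.

Lemma lip_dF V L : compact_convex_cover x V -> lipschitz_modulus F V L ->
  forall j, enorm (P j) <= L * enorm (D j).
Proof. by move=> [_ _ xV] [_ FL] j; exact: FL. Qed.

(** With max(L, L0) as modulus, the first update obeys the same bound as the others whatever L0
    is. *)
Lemma gam_lower_bound : bounded_set (range x) -> exists2 m, 0 < m & forall k, m <= gam k.
Proof.
move=> /closed_ball_cover[V VC]; have [Vc _ _] := VC.
have [L VL] := lipschitz_compact F_lip Vc.
have [Lge0 _] := VL; have hL := lip_dF VC VL.
have l0 := ada_L0 run.
have a0 : 0 < Num.sqrt a by rewrite sqrtr_gt0 (lt_le_trans _ a_ge1).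
have M0 : 0 < Num.max L L0 by rewrite lt_max l0 orbT.
exists (Num.min (gam 0%N) (cs / (Num.sqrt a * Num.max L L0))).
  by rewrite lt_min gam_gt0 divr_gt0// mulr_gt0.
move=> k; apply: (@gam_ge _ (Num.max L L0)) => //; first exact: ltW.
- move=> j; rewrite (le_trans (hL j))// ler_wpM2r ?enorm_ge0//.
  by rewrite le_max lexx.
- by rewrite le_min !ltW ?gam_gt0// divr_gt0// mulr_gt0.
- by rewrite ge_min lexx.
- rewrite -ler_pdivlMr ?mulr_gt0//.
  by rewrite ge_min lexx orbT.
- by right; rewrite le_max lexx orbT.
Qed.

Lemma ergodic_cluster p : bounded_set (range x) ->
  cluster (ergodic a x gam rho @ \oo) p -> zer (opT F g) p.
Proof.
move=> xb pc; have [m m0 hm] := gam_lower_bound xb.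
apply: (cluster_zer F_lip g_proper g_convex g_lsc pc) => z d zf d0.
have : \forall K \near \oo, `|lyapr 2 z| / (d * m) < K%:R by exact: nbhs_infty_gtr.
case=> N _ hN; exists N.+1 => // -[//|K] /= NK.
have [pf pA] := ergodic_gap K zf; rewrite -(fineK pf) lee_fin.
suff : fine (g (ergodic a x gam rho K.+1)) - fine (g z)
    + dotp (F z) (ergodic a x gam rho K.+1 - z) <= d by lra.
rewrite leNgt; apply/negP => Ad; move: pA; apply/negP; rewrite -ltNge.
have := hN K NK; rewrite ltr_pdivrMr ?mulr_gt0// => lK.
apply: (lt_le_trans lK).
have SK : K%:R * m <= \sum_(1 <= i < K.+2) gam i.+1.
  rewrite big_add1 /= big_mkord big_ord_recr /= -[leLHS]addr0 lerD//; last by rewrite ltW ?gam_gt0.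
  rewrite mulr_natl -[X in m *+ X]card_ord -sumr_const ler_sum// => i _; exact: hm.
apply: (@le_trans _ _ (d * (K%:R * m))); first by lra.
apply: ler_pM => //; first exact: ltW.
  by rewrite mulr_ge0// ltW.
exact: ltW.
Qed.

(** * Extended-valued gap and Lyapunov function *)

Lemma gapVE k z : g (x k) \is a fin_num -> g z \is a fin_num ->
  gapV F g x k z = (gapr k z)%:E.
Proof.
move=> xf zf; rewrite /gapV -(fineK xf) -(fineK zf) -!EFinB /gapr.
by congr EFin; rewrite /= -(opprB (x k)) dotpNr opprK.
Qed.

Lemma lyapUE k z : g (x k) \is a fin_num -> g z \is a fin_num ->
  lyapU F g a x gam rho k.+1 z = (lyapr k.+1 z)%:E.
Proof. by move=> xf zf; rewrite /lyapU gapVE. Qed.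

Lemma gapV_pinfty k z : g z \is a fin_num -> g (x k) \isn't a fin_num ->
  gapV F g x k z = +oo%E.
Proof.
move=> zf; rewrite /gapV -(fineK zf); have := g_proper.1 (x k).
by case: (g (x k)).
Qed.

(** Only k = 0 can occur, when x^0 lies outside dom g; upper bounds by U_1 are then trivial. *)
Lemma lyapU_pinfty k z : g z \is a fin_num -> g (x k) \isn't a fin_num ->
  lyapU F g a x gam rho k.+1 z = +oo%E.
Proof.
move=> zf xf; rewrite /lyapU gapV_pinfty// gt0_muley ?addey//.
have a0 : 0 < a by rewrite (lt_le_trans _ a_ge1).
by rewrite lte_fin mulr_gt0 ?addr_gt0 ?mulr_gt0 ?gam_gt0 ?rho_gt0.
Qed.

(** * Convergence of the iterates when c' < c *)

Lemma dX_small z e : cs < c_par a -> zer (opT F g) z -> 0 < e ->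
  exists N, forall k, (N <= k)%N -> enorm (D k) < e.
Proof.
move=> csc zz e0; pose u k := lyapr k.+2 z.
have u_anti : nonincreasing_seq u.
  by move=> k l kl; exact: (@lyapr_anti k.+1 l.+1 _ (gx_fin k) zz kl).
have u_lb : has_lbound (range u).
  by exists 0 => _ [k _ <-]; rewrite /u lyapr_ge0// gx_fin.
have ucv := nonincreasing_is_cvgn u_anti u_lb.
(* The decrements of a convergent sequence vanish, and they dominate (c^2 - c'^2) |D^k|^2. *)
have du : (fun k => u k - u k.+1) @ \oo --> 0.
  rewrite -(subrr (limn u)); apply: cvgB => //.
  by rewrite (cvg_shiftS u).
have s0 : 0 < c_par a ^+ 2 - cs ^+ 2.
  by rewrite subr_gt0 ltrXn2r// ltW// (lt_trans cs_gt0).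
have /cvgr0Pnorm_lt/(_ _ (mulr_gt0 s0 (exprn_gt0 2 e0)))[N _ hN] := du.
exists N.+2 => -[//|[//|k]]; rewrite !ltnS => Nk.
have zf := zer_fin g_proper zz.
have := lyapr_step (gx_fin k) zf.
have : 0 <= erg_weight a gam rho k.+2 * gapr k.+1 z.
  by rewrite mulr_ge0 ?erg_weight_ge0// gapr_ge0// gx_fin.
have := hN k Nk; rewrite /= ltr_norml => /andP[_].
rewrite -/(u k) -/(u k.+1) => h1 h2 h3.
rewrite -(@ltr_pXn2r _ 2) ?nnegrE ?enorm_ge0 ?ltW// -(ltr_pM2l s0); lra.
Qed.

(** The prox inequality of x^{k+1} is multiplied by rho_{k+2} and F(x^k) is recentred at F(x^{k+1}).
    The constants come from rho <= 2 and a rho_{k+2} rho_{k+1} <= 8. *)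
Lemma gapr_bound k z : g z \is a fin_num ->
  gam k.+2 * gapr k.+1 z <=
  ((2 + cs) * enorm (D k.+1) + 8 * cs * enorm (D k)) * enorm (x k.+1 - z).
Proof.
move=> zf; have a1 := a_ge1; have a2 := a_le2; have c0 := cs_gt0.
pose W := rho k.+2 *: D k.+1 - gam k.+2 *: P k.+1
  + (a * (rho k.+2 * rho k.+1) * gam k.+1) *: P k.
apply: (@le_trans _ _ (dotp W (z - x k.+1))).
  have := ler_wpM2l (ltW (rho_gt0 k.+2)) (x_prox_ineq k zf).
  have -> : F (x k) = F (x k.+1) - P k.+1 by rewrite /dF /= subKr.
  rewrite /W /gapr -(opprB z (x k.+1)) (gamS k.+1) !dotpE; lra.
rewrite (le_trans (ler_norm _))// (le_trans (dotp_le_enorm _ _))//.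
rewrite enormB ler_wpM2r ?enorm_ge0//.
apply: le_trans (ler_enormD _ _) _; rewrite /W.
have h1 : enorm (rho k.+2 *: D k.+1 - gam k.+2 *: P k.+1) <= (2 + cs) * enorm (D k.+1).
  apply: le_trans (ler_enormD _ _) _; rewrite enormN !enormZ.
  rewrite !gtr0_norm ?rho_gt0 ?gam_gt0// mulrDl lerD ?gam_dF_le//.
  by rewrite ler_wpM2r ?enorm_ge0 ?rho_le2.
rewrite lerD// enormZ ger0_norm; last first.
  by rewrite !mulr_ge0 ?(ltW (rho_gt0 _)) ?(ltW (gam_gt0 _))//; lra.
rewrite -[_ * gam k.+1 * _]mulrA.
apply: (@le_trans _ _ (8 * (cs * enorm (D k)))); last by rewrite mulrA.
apply: ler_pM; rewrite ?gam_dF_le//.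
- by rewrite !mulr_ge0 ?(ltW (rho_gt0 _))//; lra.
- by rewrite mulr_ge0 ?enorm_ge0 ?(ltW (gam_gt0 _)).
have : rho k.+2 * rho k.+1 <= 2 * 2.
  by rewrite ler_pM ?rho_le2 ?(ltW (rho_gt0 _)).
have : 0 <= rho k.+2 * rho k.+1 by rewrite mulr_ge0 ?(ltW (rho_gt0 _)).
move: (_ * _) => r r0 r4; nra.
Qed.

Lemma gam_gapr_small z0 z d : cs < c_par a -> zer (opT F g) z0 ->
  g z \is a fin_num -> 0 < d ->
  exists N, forall k, (N <= k)%N -> gam k.+1 * gapr k z < d.
Proof.
move=> csc zz0 zf d0; have [M0 hM0] := run_bounded zz0.
have c0 := cs_gt0; pose M := M0 + enorm (z0 - z).
have hM k : enorm (x k - z) <= M.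
  have -> : x k - z = (x k - z0) + (z0 - z) by rewrite subrKA.
  by rewrite (le_trans (ler_enormD _ _))// lerD2r.
have Mge0 : 0 <= M := le_trans (enorm_ge0 _) (hM 0%N).
have K0 : 0 < 2 + 9 * cs by lra.
(* 2 + 9 c' is the sum of the two coefficients in [gapr_bound], and M + 1 avoids a zero
   denominator. *)
have e0 : 0 < d / ((2 + 9 * cs) * (M + 1)) by rewrite divr_gt0// mulr_gt0//; lra.
have [N hN] := dX_small csc zz0 e0.
exists N.+1 => -[//|k]; rewrite ltnS => Nk.
apply: (le_lt_trans (gapr_bound k zf)).
have h1 := hN k Nk; have h2 := hN k.+1 (leqW Nk).
set e := d / _ in e0 h1 h2.
apply: (@le_lt_trans _ _ ((2 + 9 * cs) * e * M)).
  apply: ler_pM; rewrite ?enorm_ge0//.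
    by rewrite addr_ge0// !mulr_ge0 ?enorm_ge0//; lra.
  have := enorm_ge0 (D k); have := enorm_ge0 (D k.+1); move: h1 h2.
  move: (enorm (D k)) (enorm (D k.+1)) => u v; nra.
have : (2 + 9 * cs) * (M + 1) * e = d by rewrite /e mulrC divfK// gt_eqF// mulr_gt0//; lra.
have : 0 < (2 + 9 * cs) * e by rewrite mulr_gt0.
lra.
Qed.

Lemma gapr_small z0 z d : cs < c_par a -> zer (opT F g) z0 ->
  g z \is a fin_num -> 0 < d ->
  exists N, forall k, (N <= k)%N -> gapr k z < d.
Proof.
move=> csc zz0 zf d0.
have [M hM] := run_bounded zz0.
have [m m0 hm] := gam_lower_bound (enorm_bounded hM).
have [N hN] := gam_gapr_small csc zz0 zf (mulr_gt0 m0 d0).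
exists N => k /hN h; rewrite ltNge; apply/negP => dg.
move: h; apply/negP; rewrite -leNgt ler_pM// ltW//.
Qed.

Lemma lyapr_small z d : cs < c_par a -> zer (opT F g) z -> 0 < d ->
  exists N, forall k, (N <= k)%N -> lyapr k z < 2^-1 * enorm (x k - z) ^+ 2 + d.
Proof.
move=> csc zz d0; have zf := zer_fin g_proper zz.
have c0 := cs_gt0; have a1 := a_ge1; have a2 := a_le2.
(* The two difference terms of U_k amount to at most q e <= d/2; the gap term, with 1 + a rho_k <= 5
   and a weighted gap below d/10, stays below d/2. *)
pose q := 1 + 2 * lambda_par a * cs ^+ 2.
have l0 := lambda_par_ge0 a_ge1 a_le2.
have lc : 0 <= lambda_par a * cs ^+ 2 by rewrite mulr_ge0 ?sqr_ge0.
have q0 : 0 < q by rewrite /q; lra.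
have e0 : 0 < Num.min 1 (d / (2 * q)) by rewrite lt_min ltr01 divr_gt0// mulr_gt0.
have [N1 h1] := dX_small csc zz e0.
have [N2 h2] := gam_gapr_small csc zz zf (divr_gt0 d0 (ltr0Sn R 9)).
exists (N1 + N2).+2 => -[//|[//|k]]; rewrite !ltnS => Nk.
have hE := h1 k.+2 (leqW (leqW (leq_trans (leq_addr _ _) Nk))).
have hE' := h1 k.+1 (leqW (leq_trans (leq_addr _ _) Nk)).
have hg := h2 k.+1 (leqW (leq_trans (leq_addl _ _) Nk)).
set e := Num.min _ _ in e0 hE hE'.
have e1 : e <= 1 by rewrite /e ge_min lexx.
have eq2 : q * e <= d / 2.
  rewrite -ler_pdivlMl// mulrC (_ : d / 2 / q = d / (2 * q)); last first.
    by field; rewrite gt_eqF.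
  by rewrite /e ge_min lexx orbT.
have sq (u : R) : 0 <= u -> u < e -> u ^+ 2 <= e.
  by move=> u0 ue; rewrite expr2; nra.
have sE := sq _ (enorm_ge0 _) hE; have sE' := sq _ (enorm_ge0 _) hE'.
have hP : (gam k.+2 * rho k.+2) ^+ 2 * enorm (P k.+1) ^+ 2 <= 4 * (cs ^+ 2 * e).
  have : gam k.+2 * rho k.+2 * enorm (P k.+1) <= 2 * (cs * enorm (D k.+1)).
    rewrite -mulrA mulrCA; apply: ler_pM; rewrite ?rho_le2 ?gam_dF_le ?(ltW (rho_gt0 _))//.
    by rewrite mulr_ge0 ?enorm_ge0 ?(ltW (gam_gt0 _)).
  move=> h; rewrite -exprMn; apply: (@le_trans _ _ ((2 * (cs * enorm (D k.+1))) ^+ 2)).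
    rewrite lerXn2r// nnegrE.
      by rewrite !mulr_ge0 ?enorm_ge0 ?(ltW (gam_gt0 _)) ?(ltW (rho_gt0 _)).
    by rewrite !mulr_ge0 ?enorm_ge0 ?(ltW c0).
  rewrite !exprMn -natrX ler_pM2l// ler_pM2l ?exprn_gt0//.
have hG : (1 + a * rho k.+2) * gam k.+2 * gapr k.+1 z <= 5 * (gam k.+2 * gapr k.+1 z).
  rewrite -mulrA ler_wpM2r//.
    by rewrite mulr_ge0 ?(ltW (gam_gt0 _))// gapr_ge0// gx_fin.
  have := rho_le2 k.+2; have := rho_gt0 k.+2; nra.
have := ler_wpM2l l0 hP.
rewrite /lyapr /= -/(D k.+2) -/(P k.+1).
move: eq2 lc q0; rewrite /q; move: hG hg.
move: ((1 + a * _) * _ * _) (gam k.+2 * gapr _ _) => G1 G2.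
move: (enorm (D k.+2) ^+ 2) sE => u ue.
move: (lambda_par a) (gam k.+2 * rho k.+2) (enorm (P k.+1)) => l v w.
lra.
Qed.

Lemma cluster_solution z p : cs < c_par a -> zer (opT F g) z ->
  cluster (x @ \oo) p -> zer (opT F g) p.
Proof.
move=> csc zz pc; apply: (cluster_zer F_lip g_proper g_convex g_lsc pc) => y d yf d0.
have [N hN] := gapr_small csc zz yf d0.
exists N.+1 => // -[//|k] /=; rewrite ltnS => Nk.
rewrite -(fineK (gx_fin k)) lee_fin.
have := hN k.+1 (leqW Nk); have := gapr_mono k.+1 y; lra.
Qed.

Lemma gapV_cvg z : cs < c_par a -> zer (opT F g) z ->
  (fun k => gapV F g x k z) @ \oo --> 0%E.
Proof.
move=> csc zz; have zf := zer_fin g_proper zz; apply/fine_cvgP; split.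
  by exists 1%N => // -[//|k] _; rewrite gapVE ?gx_fin.
apply/cvgr0Pnorm_lt => d d0; have [N hN] := gapr_small csc zz zf d0.
exists N.+1 => // -[//|k] /=; rewrite ltnS => Nk.
by rewrite gapVE ?gx_fin//= ger0_norm ?gapr_ge0 ?gx_fin// hN// leqW.
Qed.

Lemma run_cvg z : cs < c_par a -> zer (opT F g) z ->
  exists p, [/\ zer (opT F g) p, x @ \oo --> p &
    (fun k => lyapU F g a x gam rho k p) @ \oo --> 0%E].
Proof.
move=> csc zz; have [M hM] := run_bounded zz.
have [V [Vc _ xV]] := closed_ball_cover (enorm_bounded hM).
have [p [_ pc]] : V `&` cluster (x @ \oo) !=set0.
  by apply: Vc; exists 0%N => // k _; exact: xV.
have zp := cluster_solution csc zz pc; have pf := zer_fin g_proper zp.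
have small d : 0 < d -> exists N, forall k, (N <= k)%N -> lyapr k.+2 p < d.
  move=> d0; have d2 : 0 < d / 2 by lra.
  have [N hN] := lyapr_small csc zp d2.
  (* Within this radius |x^k - p|^2 / 2 <= d/2, the other half being left by [lyapr_small]. *)
  have r0 : 0 < Num.min 1 d by rewrite lt_min ltr01.
  have [|k [Nk pk]] := cluster_seq_near (P := fun k => (N.+2 <= k)%N) pc _ (enorm_near p r0).
    by exists N.+2.
  case: k Nk pk => [//|[//|k]]; rewrite !ltnS /= => Nk pk.
  exists k => l kl; apply: (le_lt_trans (@lyapr_anti k.+1 l.+1 _ (gx_fin k) zp kl)).
  apply: (lt_le_trans (hN _ (leqW (leqW Nk)))).
  move: pk; rewrite lt_min => /andP[p1 pd].
  have := enorm_ge0 (x k.+2 - p); nra.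
exists p; split=> //.
  apply/cvgrPdist_lt => e e0; have [N hN] := small _ (divr_gt0 (exprn_gt0 2 e0) (ltr0Sn R 1)).
  exists N.+2 => // -[//|[//|k]] /=; rewrite !ltnS => Nk.
  rewrite distrC (le_lt_trans (norm_le_enorm _))//.
  rewrite -(@ltr_pXn2r _ 2) ?nnegrE ?enorm_ge0 ?ltW//.
  have := hN k Nk; have := lyapr_ge k.+2 p.
  have : 0 <= (1 + a * rho k.+2) * gam k.+2 * gapr k.+1 p.
    by rewrite mulr_ge0 ?lyapr_weight_ge0// gapr_ge0// gx_fin.
  rewrite /=; lra.
apply/fine_cvgP; split.
  by exists 2%N => // -[//|[//|k]] _; rewrite lyapUE ?gx_fin.
apply/cvgr0Pnorm_lt => d d0; have [N hN] := small _ d0.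
exists N.+2 => // -[//|[//|k]] /=; rewrite !ltnS => Nk.
by rewrite lyapUE ?gx_fin//= ger0_norm ?lyapr_ge0 ?gx_fin// hN.
Qed.

(** * Descent, stepsize and gap estimates in extended-valued form *)

Lemma lyapU_descent z k : zer (opT F g) z ->
  (0 <= lyapU F g a x gam rho k.+1 z)%E /\
  ((0 < k)%N -> (lyapU F g a x gam rho k.+1 z <= lyapU F g a x gam rho k z)%E).
Proof.
move=> zz; have zf := zer_fin g_proper zz; split.
  have [xf|xN] := boolP (g (x k) \is a fin_num).
    by rewrite lyapUE// lee_fin lyapr_ge0.
  by rewrite lyapU_pinfty// leey.
case: k => // k _; have [xf|xN] := boolP (g (x k) \is a fin_num).
  by rewrite !lyapUE ?gx_fin// lee_fin lyapr_anti.
by rewrite [leRHS]lyapU_pinfty// leey.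
Qed.

Lemma stepsize_bound V L : compact_convex_cover x V -> lipschitz_modulus F V L ->
  gam 0%N * L0 <= cs \/ L0 <= L ->
  forall k, (Order.min (gam 0%N)%:E (ediv cs (Num.sqrt a * L)) <= (gam k)%:E)%E.
Proof.
move=> VC VL hL0 k; have [Lge0 _] := VL; have hL := lip_dF VC VL.
have a0 : 0 < Num.sqrt a by rewrite sqrtr_gt0 (lt_le_trans _ a_ge1).
(* For L = 0 the quotient is infinite and the bound reduces to gam_0. *)
have g0 := gam_gt0; rewrite /ediv; case: eqP => [e|/eqP aL].
  rewrite ge_min lee_fin (gam_ge k Lge0 hL (ltW (g0 0%N)))//.
  by rewrite e mulr0 ltW.
have aL0 : 0 < Num.sqrt a * L by rewrite lt_def aL mulr_ge0// ltW.
rewrite -EFin_min lee_fin; apply: (gam_ge k Lge0 hL) => //.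
- by rewrite le_min !ltW ?g0// divr_gt0.
- by rewrite ge_min lexx.
- by rewrite -ler_pdivlMr// ge_min lexx orbT.
Qed.

Lemma gapV_ge0 k z : zer (opT F g) z -> (0 <= gapV F g x k z)%E.
Proof.
move=> zz; have zf := zer_fin g_proper zz.
have [xf|xN] := boolP (g (x k) \is a fin_num).
  by rewrite gapVE// lee_fin gapr_ge0.
by rewrite gapV_pinfty// leey.
Qed.

Lemma min_gapV_ge0 K z : zer (opT F g) z -> (0 <= min_gapV F g x K z)%E.
Proof.
by move=> zz; apply: le_bigmin => [|i _]; [rewrite leey|exact: gapV_ge0].
Qed.

Lemma min_gapV_le K k z : (k <= K)%N -> (min_gapV F g x K z <= gapV F g x k z)%E.
Proof.
move=> kK; exact: (bigmin_le _ (Ordinal (kK : (k < K.+1)%N)) (fun i : 'I_K.+1 => gapV F g x i z)).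
Qed.

Lemma min_gapV_average m K z : zer (opT F g) z -> g (x m) \is a fin_num ->
  (m <= K)%N ->
  (min_gapV F g x K z <= (lyapr m.+1 z / \sum_(m <= i < K.+1) gam i.+1)%:E)%E.
Proof.
move=> zz xf mK; have zf := zer_fin g_proper zz.
have gf i : (m <= i)%N -> g (x i) \is a fin_num.
  by case: i => [|i _]; [rewrite leqn0 => /eqP e; move: xf; rewrite e|exact: gx_fin].
have vf : min_gapV F g x K z \is a fin_num.
  rewrite ge0_fin_numE ?min_gapV_ge0//.
  by apply: le_lt_trans (min_gapV_le z mK) _; rewrite gapVE// ltry.
have S0 : 0 < \sum_(m <= i < K.+1) gam i.+1.
  rewrite big_nat_recr//= ltr_wpDl ?gam_gt0// sumr_ge0// => i _.
  by rewrite ltW ?gam_gt0.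
rewrite -(fineK vf) lee_fin ler_pdivlMr//; apply: gap_average => //.
  move=> i /andP[mi iK]; rewrite -lee_fin fineK// -gapVE ?gf//.
  exact: min_gapV_le.
by rewrite -lee_fin fineK// min_gapV_ge0.
Qed.

Lemma min_gapV_bound K z : zer (opT F g) z ->
  (min_gapV F g x K z <=
   lyapU F g a x gam rho 1 z * ((\sum_(1 <= k < K.+2) gam k)^-1)%:E)%E.
Proof.
move=> zz; have zf := zer_fin g_proper zz.
have S0 : 0 < \sum_(0 <= k < K.+1) gam k.+1.
  rewrite big_nat_recr//= ltr_wpDl ?gam_gt0// sumr_ge0// => i _.
  by rewrite ltW ?gam_gt0.
rewrite big_add1 /=; have [xf|xN] := boolP (g (x 0%N) \is a fin_num).
  by rewrite lyapUE// -EFinM min_gapV_average.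
by rewrite lyapU_pinfty// gt0_mulye ?leey// lte_fin invr_gt0.
Qed.

(** The constant is taken from U_2 because U_1 may be infinite; the K remaining stepsizes are
    bounded below by a common m > 0. *)
Lemma min_gapV_rate z : zer (opT F g) z -> exists C, forall K, (0 < K)%N ->
  (0 <= min_gapV F g x K z)%E /\ (min_gapV F g x K z <= (C / K%:R)%:E)%E.
Proof.
move=> zz; have [M hM] := run_bounded zz.
have [m m0 hm] := gam_lower_bound (enorm_bounded hM).
exists (lyapr 2 z / m) => K K0; split; first exact: min_gapV_ge0.
apply: le_trans (min_gapV_average zz (gx_fin 0) K0) _.
have Kp : 0 < K%:R :> R by rewrite ltr0n.
rewrite lee_fin -mulrA ler_wpM2l ?lyapr_ge0 ?gx_fin// -invfM.
have le : m * K%:R <= \sum_(1 <= i < K.+1) gam i.+1.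
  rewrite big_add1 /= big_mkord mulr_natr -[X in m *+ X]card_ord -sumr_const.
  by apply: ler_sum => i _; exact: hm.
by rewrite lef_pV2// posrE ?mulr_gt0// (lt_le_trans _ le) ?mulr_gt0.
Qed.

End Run.

Theorem theorem2p6 (R : realType) (n : nat) (F : 'rV[R]_n -> 'rV[R]_n)
    (g : 'rV[R]_n -> \bar R) (a : R)
    (F_mono : monotone_map F) (F_lip : locally_lipschitz F)
    (g_proper : proper_fun g) (g_convex : econvex g)
    (g_lsc : lower_semicontinuous g)
    (zer_nonempty : zer (opT F g) !=set0)
    (a_ge1 : 1 <= a) (a_le2 : a <= 2) :
  (forall (L0 : R) (x : nat -> 'rV[R]_n) (gam rho : nat -> R),
    adaFRBplus F g a (c_par a) L0 x gam rho ->
    (* Lyapunov descent *)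
    (forall xs, zer (opT F g) xs ->
       forall k : nat,
         (0 <= lyapU F g a x gam rho k.+1 xs)%E /\
         ((0 < k)%N ->
          (lyapU F g a x gam rho k.+1 xs <= lyapU F g a x gam rho k xs)%E)) /\
    bounded_set (range x) /\
    (* stepsize magnitude; the disjunction excludes an L0 so large that the very
       first update, through c / L0, falls below the bound *)
    (exists V, compact_convex_cover x V) /\
    (forall V, compact_convex_cover x V ->
       (exists L, lipschitz_modulus F V L) /\
       (forall L, lipschitz_modulus F V L ->
          gam 0%N * L0 <= c_par a \/ L0 <= L ->
          forall k : nat,
            (Order.min (gam 0%N)%:E (ediv (c_par a) (Num.sqrt a * L))
             <= (gam k)%:E)%E)) /\
    (* Stampacchia gap *)
    (forall xs, zer (opT F g) xs ->
       (forall K : nat,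
          (min_gapV F g x K xs
           <= lyapU F g a x gam rho 1 xs
              * ((\sum_(1 <= k < K.+2) gam k)^-1)%:E)%E) /\
       (exists C : R, forall K : nat, (0 < K)%N ->
          (0 <= min_gapV F g x K xs)%E /\
          (min_gapV F g x K xs <= (C / K%:R)%:E)%E)) /\
    (* ergodic subsequential convergence *)
    bounded_set (range (ergodic a x gam rho)) /\
    (forall p, cluster (ergodic a x gam rho @ \oo) p -> zer (opT F g) p)) /\
  (forall c' : R, 0 < c' -> c' < c_par a ->
   forall (L0 : R) (x : nat -> 'rV[R]_n) (gam rho : nat -> R),
    adaFRBplus F g a c' L0 x gam rho ->
    (* variant with c' < c: gaps vanish *)
    (forall xs, zer (opT F g) xs ->
       (fun k => gapV F g x k xs) @ \oo --> 0%E) /\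
    (* variant with c' < c: sequential convergence *)
    (exists xinf, [/\ zer (opT F g) xinf,
       x @ \oo --> xinf &
       (fun k => lyapU F g a x gam rho k xinf) @ \oo --> 0%E])).
Proof.
have c0 := c_par_gt0 a_ge1 a_le2; have [z0 zz0] := zer_nonempty.
split=> [L0 x gam rho run|c' c'0 c'c L0 x gam rho run]; last first.
  have c'le := ltW c'c; split=> [xs zxs|].
    exact: (gapV_cvg F_mono F_lip g_proper g_convex a_ge1 a_le2 c'0 c'le run c'c zxs).
  exact: (run_cvg F_mono F_lip g_proper g_convex g_lsc a_ge1 a_le2 c'0 c'le run c'c zz0).
have cl := lexx (c_par a).
have [M hM] := run_bounded F_mono g_proper g_convex a_ge1 a_le2 c0 cl run zz0.
have xb := enorm_bounded hM.
split; last split; last split; last split; last split; last split.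
- move=> xs zxs k.
  exact: (lyapU_descent F_mono g_proper g_convex a_ge1 a_le2 c0 cl run k zxs).
- exact: xb.
- exact: closed_ball_cover.
- move=> V VC; split=> [|L VL hL0 k].
    by have [Vc _ _] := VC; exact: lipschitz_compact.
  exact: (stepsize_bound a_ge1 a_le2 c0 run VC VL hL0 k).
- move=> xs zxs; split=> [K|].
    exact: (min_gapV_bound F_mono g_proper g_convex a_ge1 a_le2 c0 cl run K zxs).
  exact: (min_gapV_rate F_mono F_lip g_proper g_convex a_ge1 a_le2 c0 cl run zxs).
- exact: (ergodic_bounded a_ge1 a_le2 c0 run xb).
- move=> p pc; exact: (ergodic_cluster F_mono F_lip g_proper g_convex g_lsc
    a_ge1 a_le2 c0 cl run xb pc).
Qed.
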